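(* The property of being algebraically periodic with periodic direction field $K$ is a scissors congruence invariant: if $S$ and $S'$ are scissors congruent translation surfaces and $S$ is algebraically periodic with periodic direction field $K$, then $S'$ is algebraically periodic with periodic direction field $K$.
   Context: A translation surface is a compact (connected, oriented) surface $S$ obtained by gluing finitely many polygons in $\mathbb{R}^2$ along parallel edges by translations. Translation surfaces $S$ and $S'$ are scissors congruent if both can be assembled from the same finite collection of triangles in $\mathbb{R}^2$ with perhaps different collections of gluing maps, where gluing maps identify entire edges with entire edges and are restrictions of translations. View $\mathbb{R}^2$ and $\mathbb{R}$ as $\mathbb{Q}$-vector spaces. Take an edge-to-edge decomposition of $S$ into Euclidean triangles $\Delta_j$ whose vertex set contains the singular points, and let $v_j,w_j\in\mathbb{R}^2$ be two successive sides of $\Delta_j$ in counterclockwise order. The $J$-invariant is $J(S)=\sum_j v_j\wedge w_j\in\mathbb{R}^2\wedge_{\mathbb{Q}}\mathbb{R}^2$ (independent of the triangulation). For $0\ne v\in\mathbb{R}^2$ let $\pi:\mathbb{R}^2\to\mathbb{R}$ be the orthogonal projection with kernel $\mathbb{R}v$, and let $\mathrm{SAF}_v(S)\in\mathbb{R}\wedge_{\mathbb{Q}}\mathbb{R}$ be the image of $J(S)$ under the map induced by $\pi$. The direction $v$ is algebraically periodic if $\mathrm{SAF}_v(S)=0$. $S$ is algebraically periodic if it has at least three algebraically periodic directions. In that case, after a linear change of coordinates so that the directions of slopes $0,1,\infty$ are algebraically periodic, the set of finite slopes of algebraically periodic directions is a subfield of $\mathbb{R}$ (independent of the choices), called the periodic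 direction field of $S$. *)

(* Defs.v *)
From HB Require Import structures.
From mathcomp Require Import all_boot all_order all_algebra.
From mathcomp Require Import generic_quotient ring_quotient freeg.
From mathcomp Require Import all_classical all_reals all_analysis.
From mathcomp Require Import ring.
From Stdlib Require Import Relations.Relation_Operators.

Set Implicit Arguments.
Unset Strict Implicit.
Unset Printing Implicit Defensive.

Import Order.TTheory GRing.Theory Num.Theory.
Import numFieldNormedType.Exports.

Local Open Scope classical_set_scope.
Local Open Scope ring_scope.
Local Open Scope quotient_scope.

(** * The exterior square of a rational vector space *)

Section Wedge.
Variable V : lmodType rat.

(* The subspace of the free rational vector space on [V * V] spanned by the
   relations of a bilinear alternating product. *)
Inductive wedge_relation : {freeg (V * V) / rat} -> Prop :=
| wedge_addl u v w :
    wedge_relation (<< (u + v, w) >> - << (u, w) >> - << (v, w) >>)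
| wedge_addr u v w :
    wedge_relation (<< (u, v + w) >> - << (u, v) >> - << (u, w) >>)
| wedge_scalel a u v :
    wedge_relation (<< (a *: u, v) >> - a *: << (u, v) >>)
| wedge_scaler a u v :
    wedge_relation (<< (u, a *: v) >> - a *: << (u, v) >>)
| wedge_alt u : wedge_relation << (u, u) >>
| wedge_zero : wedge_relation 0
| wedge_lin a D E :
    wedge_relation D -> wedge_relation E -> wedge_relation (a *: D + E).

Definition wedge_null (D : {freeg (V * V) / rat}) : bool :=
  `[< wedge_relation D >].

Fact wedge_null_zmod_closed : zmod_closed wedge_null.
Proof.
split=> [|D E /asboolP D0 /asboolP E0]; apply/asboolP; first exact: wedge_zero.
by rewrite addrC -scaleN1r; apply: wedge_lin.
Qed.

HB.instance Definition _ :=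
  GRing.isZmodClosed.Build {freeg (V * V) / rat} wedge_null
    wedge_null_zmod_closed.

Local Notation wedge_quot :=
  (Quotient.quot (GRing.ZmodClosed.clone _ wedge_null _)).

Definition wedge2 : Type := wedge_quot.
HB.instance Definition _ := GRing.Zmodule.on wedge2.

Definition wedge_pi (D : {freeg (V * V) / rat}) : wedge2 :=
  \pi_wedge_quot D.

Definition wedge_repr (x : wedge2) : {freeg (V * V) / rat} :=
  repr (x : wedge_quot).

Lemma wedge_reprK x : wedge_pi (wedge_repr x) = x.
Proof. exact: reprK. Qed.

Lemma wedge_piP D E : wedge_pi D = wedge_pi E <-> wedge_relation (D - E).
Proof.
rewrite /wedge_pi; split=> [|DE].
  move/eqP; rewrite -[_ == _]Quotient.idealrBE.
  by move/asboolP.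
apply/eqP; rewrite -[_ == _]Quotient.idealrBE; exact/asboolP.
Qed.

Lemma wedge_piD D E : wedge_pi (D + E) = wedge_pi D + wedge_pi E.
Proof. exact: (raddfD \pi_wedge_quot). Qed.

Definition wedge_scale (a : rat) (x : wedge2) : wedge2 :=
  wedge_pi (a *: wedge_repr x).

Lemma wedge_piZ a D : wedge_pi (a *: D) = wedge_scale a (wedge_pi D).
Proof.
apply/wedge_piP; rewrite -scalerBr -[_ *: _]addr0; apply: wedge_lin.
  by apply/wedge_piP; rewrite wedge_reprK.
exact: wedge_zero.
Qed.

Fact wedge_scaleA a b x :
  wedge_scale a (wedge_scale b x) = wedge_scale (a * b) x.
Proof. by rewrite -(wedge_reprK x) -!wedge_piZ scalerA. Qed.

Fact wedge_scale1 : left_id 1 wedge_scale.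
Proof. by move=> x; rewrite -(wedge_reprK x) -wedge_piZ scale1r. Qed.

Fact wedge_scaleDr : right_distributive wedge_scale +%R.
Proof.
move=> a x y; rewrite -(wedge_reprK x) -(wedge_reprK y).
by rewrite -wedge_piD -!wedge_piZ scalerDr wedge_piD.
Qed.

Fact wedge_scaleDl x : {morph wedge_scale^~ x : a b / a + b}.
Proof.
by move=> a b; rewrite -(wedge_reprK x) -!wedge_piZ scalerDl wedge_piD.
Qed.

HB.instance Definition _ := GRing.Zmodule_isLmodule.Build rat wedge2
  wedge_scaleA wedge_scale1 wedge_scaleDr wedge_scaleDl.

Definition wedge (u v : V) : wedge2 := wedge_pi << (u, v) >>.

End Wedge.


Section WedgeTheory.
Variable V : lmodType rat.
Implicit Types u v w : V.

Let wedge_eqP (D E F : {freeg (V * V) / rat}) :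
  wedge_relation (D - E - F) -> wedge_pi D = wedge_pi E + wedge_pi F.
Proof. by rewrite -addrA -opprD -wedge_piD => /wedge_piP. Qed.

Lemma wedgeDl u v w : wedge (u + v) w = wedge u w + wedge v w.
Proof. exact/wedge_eqP/wedge_addl. Qed.

Lemma wedgeDr u v w : wedge u (v + w) = wedge u v + wedge u w.
Proof. exact/wedge_eqP/wedge_addr. Qed.

Lemma wedgeZl a u v : wedge (a *: u) v = a *: wedge u v.
Proof.
by rewrite -[RHS]/(wedge_scale _ _) -wedge_piZ; apply/wedge_piP/wedge_scalel.
Qed.

Lemma wedgeZr a u v : wedge u (a *: v) = a *: wedge u v.
Proof.
by rewrite -[RHS]/(wedge_scale _ _) -wedge_piZ; apply/wedge_piP/wedge_scaler.
Qed.

Lemma wedgevv u : wedge u u = 0.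
Proof.
have wedge_pi0 : wedge_pi 0 = 0 :> wedge2 V.
  by apply: (addIr (wedge_pi 0)); rewrite -wedge_piD !add0r.
by rewrite -wedge_pi0; apply/wedge_piP; rewrite subr0; apply: wedge_alt.
Qed.

End WedgeTheory.

Section WedgeMap.
Variables (V W : lmodType rat) (f : {linear V -> W}).

Definition wedge_map (x : wedge2 V) : wedge2 W :=
  fglift (fun uv => wedge (f uv.1) (f uv.2)) (wedge_repr x).

Let lift := fglift (fun uv : V * V => wedge (f uv.1) (f uv.2)).

Let liftB : {morph lift : D E / D - E}.
Proof. exact: lift_is_additive. Qed.

Let lift0 : lift 0 = 0.
Proof. by rewrite -[0 in LHS](subrr 0) liftB subrr. Qed.

Let liftD : {morph lift : D E / D + E}.
Proof.
by move=> D E; rewrite -{1}[E]opprK -[- E]sub0r !liftB lift0 sub0r opprK.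
Qed.

Let lift1 uv : lift << uv >> = wedge (f uv.1) (f uv.2).
Proof. by rewrite /lift liftU scale1r. Qed.

Let liftZ a : {morph lift : D / a *: D}.
Proof.
have lift_sum I (r : seq I) (F : I -> {freeg (V * V) / rat}) :
  lift (\sum_(i <- r) F i) = \sum_(i <- r) lift (F i).
  by rewrite (big_morph lift liftD lift0).
move=> D; rewrite [a *: D]/(fgscale a D) /fgscale -{3}[D]freeg_sumE.
rewrite !lift_sum scaler_sumr; apply: eq_bigr => uv _.
by rewrite /lift !liftU scalerA.
Qed.

Let lift_null D : wedge_relation D -> lift D = 0.
Proof.
elim=> [u v w|u v w|a u v|a u v|u||a E F _ E0 _ F0] /=.
- by rewrite !liftB !lift1 /= linearD wedgeDl addrAC addrK subrr.
- by rewrite !liftB !lift1 /= linearD wedgeDr addrAC addrK subrr.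
- by rewrite liftB liftZ !lift1 /= linearZ wedgeZl subrr.
- by rewrite liftB liftZ !lift1 /= linearZ wedgeZr subrr.
- by rewrite lift1 wedgevv.
- exact: lift0.
- by rewrite liftD liftZ E0 F0 scaler0 addr0.
Qed.

Let wedge_map_pi D : wedge_map (wedge_pi D) = lift D.
Proof.
apply/eqP; rewrite -subr_eq0 -liftB; apply/eqP/lift_null/wedge_piP.
exact: wedge_reprK.
Qed.

Lemma wedge_mapE u v : wedge_map (wedge u v) = wedge (f u) (f v).
Proof. by rewrite wedge_map_pi lift1. Qed.

Fact wedge_map_is_linear : linear wedge_map.
Proof.
move=> a x y; rewrite -(wedge_reprK x) -(wedge_reprK y).
rewrite -[a *: _]/(wedge_scale _ _) -wedge_piZ -wedge_piD !wedge_map_pi.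
by rewrite liftD liftZ.
Qed.

HB.instance Definition _ :=
  GRing.isLinear.Build rat (wedge2 V) (wedge2 W) *:%R wedge_map
    wedge_map_is_linear.

End WedgeMap.

(** * Restriction of scalars to the rationals *)

Section RestrictScalars.
Variables (F : numFieldType) (E : lmodType F).

Definition rat_space : Type := E.
HB.instance Definition _ := GRing.Zmodule.on rat_space.

Definition rat_scale (q : rat) (x : rat_space) : rat_space :=
  (ratr q : F) *: (x : E).

Fact rat_scaleA p q x : rat_scale p (rat_scale q x) = rat_scale (p * q) x.
Proof. by rewrite /rat_scale scalerA -rmorphM. Qed.

Fact rat_scale1 : left_id 1 rat_scale.
Proof. by move=> x; rewrite /rat_scale rmorph1 scale1r. Qed.

Fact rat_scaleDr : right_distributive rat_scale +%R.
Proof. by move=> q x y; rewrite /rat_scale scalerDr. Qed.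

Fact rat_scaleDl x : {morph rat_scale^~ x : p q / p + q}.
Proof. by move=> p q; rewrite /rat_scale rmorphD scalerDl. Qed.

HB.instance Definition _ := GRing.Zmodule_isLmodule.Build rat rat_space
  rat_scaleA rat_scale1 rat_scaleDr rat_scaleDl.

End RestrictScalars.

(** * Plane geometry *)

Notation plane R := 'rV[R]_2.

Section Plane.
Variable R : realType.
Implicit Types u v w x : plane R.

Definition vec (a b : R) : plane R := \row_j (if j == 0 then a else b).

Definition cross v w : R := v 0 0 * w 0 1 - v 0 1 * w 0 0.

Definition length2 v : R := Num.sqrt (v 0 0 ^+ 2 + v 0 1 ^+ 2).

(* The orthogonal projection onto the line orthogonal to [v], identified with
   the real line by means of the unit normal vector of [v]. *)
Definition orth_proj v (x : rat_space (plane R)) : rat_space R^o :=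
  cross v x / length2 v.

Fact orth_proj_is_linear v : linear (orth_proj v).
Proof.
move=> q x y; rewrite /orth_proj /cross.
rewrite -[q *: (_ : rat_space R^o)]/(ratr q * _ : R).
rewrite -[q *: x]/(ratr q *: (x : plane R)) !mxE mulrA -mulrDl.
by congr (_ / _); ring.
Qed.

HB.instance Definition _ v :=
  GRing.isLinear.Build rat (rat_space (plane R)) (rat_space R^o) *:%R
    (orth_proj v) (orth_proj_is_linear v).

(* A closed region of the plane together with the corners of its boundary,
   listed in cyclic order; the [k]-th side runs from the [k]-th corner to the
   next one. *)
Record figure := Figure {
  nb_sides : nat;
  corner : 'I_nb_sides -> plane R;
  region : set (plane R)
}.

Definition side (P : figure) (k : 'I_(nb_sides P)) : plane R :=
  corner (ordS k) - corner k.

Definition edge (P : figure) (k : 'I_(nb_sides P)) : set (plane R) :=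
  [set corner k + t *: side k | t in `[0, 1]].

Definition boundary (P : figure) : set (plane R) := \bigcup_k @edge P k.

Definition simple_polygon (P : figure) : Prop :=
  [/\ (2 < nb_sides P)%N,
      (* the closed polygonal line is a simple closed curve *)
      forall (k l : 'I_(nb_sides P)) (s t : R),
        0 <= s < 1 -> 0 <= t < 1 ->
        corner k + s *: side k = corner l + t *: side l -> k = l /\ s = t,
      (* it turns counterclockwise: its signed area is positive *)
      0 < \sum_(k < nb_sides P) cross (corner k) (corner (ordS k)) &
      (* the region is the curve and its inside, in the sense of the Jordan
         curve theorem *)
      region P = boundary P `|`
        [set x | ~ boundary P x /\
           bounded_set (connected_component (~` boundary P) x)]].

Record triangle := Triangle {
  apex : 'I_3 -> plane R;
  apex_ccw : 0 < cross (apex 1 - apex 0) (apex 2%:R - apex 1)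
}.

Definition triangle_figure (T : triangle) : figure := {|
  nb_sides := 3;
  corner := apex T;
  region := [set x | exists a : 'I_3 -> R,
    [/\ forall k, 0 <= a k, \sum_k a k = 1 & x = \sum_k a k *: apex T k]]
|}.

(** * Translation surfaces *)

Section Gluing.
Variables (n : nat) (P : 'I_n -> figure).

Definition side_index : Type := {i : 'I_n & 'I_(nb_sides (P i))}.

(* With the boundaries counterclockwise, the translation carrying a side to
   its mate puts the two regions on opposite sides of the common edge exactly
   when it reverses the direction of the side. *)
Record gluing := Gluing {
  mate : side_index -> side_index;
  mateK : involutive mate;
  mate_side : forall e, side (tagged (mate e)) = - side (tagged e)
}.

Variable g : gluing.

(* The points of a side [e] are moved by the translation that takes the start
   of [e] to the end of its mate. *)
Inductive glue_step : 'I_n * plane R -> 'I_n * plane R -> Prop :=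
| GlueStep (e : side_index) x of edge (tagged e) x :
    glue_step (tag e, x)
      (tag (mate g e),
       x + (corner (ordS (tagged (mate g e))) - corner (tagged e))).

(* [phi] exhibits [S] as the topological quotient of the disjoint union of the
   regions by the gluing maps. The value of [phi i] outside the [i]-th region
   is irrelevant. *)
Definition assembled (S : topologicalType) (phi : 'I_n -> plane R -> S) :=
  [/\ forall p, exists i, exists2 x, region (P i) x & phi i x = p,
      forall i j x y, region (P i) x -> region (P j) y ->
        (phi i x = phi j y <->
         clos_refl_sym_trans _ glue_step (i, x) (j, y)) &
      forall A : set S,
        closed A <-> forall i, closed (region (P i) `&` phi i @^-1` A)].

End Gluing.

(* The manifold structure is not a field: it follows from [ts_assembled], every
   side being paired with exactly one other side. *)
Record translation_surface := TranslationSurface {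
  ts_space :> topologicalType;
  ts_size : nat;
  ts_polygon : 'I_ts_size -> figure;
  ts_simple : forall i, simple_polygon (ts_polygon i);
  ts_gluing : gluing ts_polygon;
  ts_map : 'I_ts_size -> plane R -> ts_space;
  ts_assembled : assembled ts_gluing ts_map;
  ts_hausdorff : hausdorff_space ts_space;
  ts_compact : compact [set: ts_space];
  ts_connected : connected [set: ts_space];
  ts_nonempty : [set: ts_space] !=set0
}.

(* [phi], defined on the region [D], is a translation when read in the
   parametrization [psi] of an open subset of the surface by [U]; at a boundary
   point of [D] only the displacements [h] that stay in [D] matter. *)
Definition translation_compatible (S : Type) (D : set (plane R))
    (phi : plane R -> S) (U : set (plane R)) (psi : plane R -> S) :=
  forall x u, D x -> U u -> phi x = psi u ->
    \forall h \near (0 : plane R), D (x + h) -> phi (x + h) = psi (u + h).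

(* The (inverses of the) charts of the maximal translation atlas. *)
Definition flat_chart (S : translation_surface) (U : set (plane R))
    (psi : plane R -> S) : Prop :=
  [/\ open U, {within U, continuous psi}, {in U &, injective psi},
      forall V, open V -> V `<=` U -> open (psi @` V) &
      forall i : 'I_(ts_size S), translation_compatible
        (region (ts_polygon i)) (ts_map i) U psi].

(* A corner of a polygon whose total angle in the surface is [2 * pi] is in the
   image of a flat chart; a cone point of larger angle is not. *)
Definition singular (S : translation_surface) (p : S) : Prop :=
  ~ exists U psi, @flat_chart S U psi /\ (psi @` U) p.

(* The triangles [T], glued edge to edge, make up the surface [S] with its
   translation structure, the singular points being vertices. *)
Definition triangulates (S : translation_surface) n (T : 'I_n -> triangle) :=
  exists (g : gluing (triangle_figure \o T)) (phi : 'I_n -> plane R -> S),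
    [/\ assembled g phi,
        forall U psi, flat_chart U psi -> forall i, translation_compatible
          (region (triangle_figure (T i))) (phi i) U psi &
        forall p, singular p -> exists i k, p = phi i (apex (T i) k)].

Definition scissors_congruent (S S' : translation_surface) : Prop :=
  exists n (T : 'I_n -> triangle), triangulates S T /\ triangulates S' T.

(** * Algebraic periodicity *)

Definition J_sum n (T : 'I_n -> triangle) : wedge2 (rat_space (plane R)) :=
  \sum_i wedge (apex (T i) 1 - apex (T i) 0 : rat_space (plane R))
               (apex (T i) 2%:R - apex (T i) 1 : rat_space (plane R)).

(* [J_sum T] for some choice of a triangulation [T] of [S]; the default value 0
   is idle, as every translation surface has a triangulation. *)
Definition J_invariant (S : translation_surface) :
    wedge2 (rat_space (plane R)) :=
  xget 0 [set j | exists n (T : 'I_n -> triangle),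
                    triangulates S T /\ j = J_sum T].

Definition SAF v (S : translation_surface) : wedge2 (rat_space R^o) :=
  wedge_map (orth_proj v) (J_invariant S).

Definition algebraically_periodic_direction (S : translation_surface) v :=
  v != 0 /\ SAF v S = 0.

(* Two nonzero vectors have the same direction when they are parallel. *)
Definition algebraically_periodic (S : translation_surface) : Prop :=
  exists v1 v2 v3,
    [/\ algebraically_periodic_direction S v1,
        algebraically_periodic_direction S v2 &
        algebraically_periodic_direction S v3] /\
    [/\ cross v1 v2 != 0, cross v1 v3 != 0 & cross v2 v3 != 0].

(* A linear change of coordinates is given by a new basis, the rows of [B]: the
   vector with new coordinates [w] is [w *m B]. *)
Definition periodic_slope (S : translation_surface) (B : 'M[R]_2) : set R :=
  [set m | algebraically_periodic_direction S (vec 1 m *m B)].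

Definition normalizing_basis (S : translation_surface) (B : 'M[R]_2) : Prop :=
  [/\ B \in unitmx, periodic_slope S B 0, periodic_slope S B 1 &
      algebraically_periodic_direction S (vec 0 1 *m B)].

Definition periodic_direction_field (S : translation_surface) (K : set R) :=
  exists2 B, normalizing_basis S B & K = periodic_slope S B.

End Plane.

(* Main.v *)
(** The heart of the matter is that [J_sum T] does not depend on the
triangulation [T] of [S]. Given two triangulations [T] and [T'], cut the
triangles of [T] into very small ones by repeated midpoint subdivision, which
does not change the sum, and push every vertex of the subdivision to a nearby
corner of the triangle of [T'] that contains it (simplicial approximation). The
change in the sum is a sum over edges, which cancels because every edge has a
mate. After the push each small triangle is either degenerate or a copy, up to
sign, of a triangle of [T'], so [J_sum T] is a combination of the contributions
of the triangles of [T'] with integer coefficients; counting the crossings of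
an edge of [T'] shows that the coefficients of adjacent triangles are equal.
Since [S] is connected, [J_sum T] is [d] times [J_sum T'] for an integer [d]
that also relates the areas. The areas are positive and the roles of [T] and
[T'] can be exchanged, whence [d = 1].

The flat structure enters through [local_translation]: near any point of [S],
even a singular one, the coordinates of the two triangulations differ by a
translation. *)

Require Import Defs.
From mathcomp Require Import all_boot all_order all_algebra.
From mathcomp Require Import all_classical all_reals all_analysis.
From mathcomp Require Import ring lra.
From Stdlib Require Import Relations.Relation_Operators.

Set Implicit Arguments.
Unset Strict Implicit.
Unset Printing Implicit Defensive.

Import Order.TTheory GRing.Theory Num.Theory.
Import numFieldNormedType.Exports.

Local Open Scope classical_set_scope.
Local Open Scope ring_scope.

(** * Triangles and barycentric coordinates *)

Lemma ord3P (k : 'I_3) : [\/ k = 0, k = 1 | k = 2%:R].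
Proof.
case: k => [[|[|[|//]]] lt_k3]; [apply: Or31 | apply: Or32 | apply: Or33];
  exact: val_inj.
Qed.

Lemma ordS3E (k : 'I_3) : ordS k = k + 1.
Proof. by case: (ord3P k) => ->; apply: val_inj. Qed.

Lemma sum_ord3 (W : nmodType) (F : 'I_3 -> W) :
  \sum_k F k = F 0 + F 1 + F 2%:R.
Proof.
rewrite !big_ord_recl big_ord0 addr0 addrA.
by congr (F _ + F _ + F _); apply: val_inj.
Qed.

Section Barycentric.
Variable R : realType.
Implicit Types (T : triangle R) (k l : 'I_3) (x h : plane R).

Lemma crossDr u v w : cross u (v + w) = cross u v + cross u w :> R.
Proof. by rewrite /cross !mxE; ring. Qed.

Lemma crossZr u a v : cross u (a *: v) = a * cross u v :> R.
Proof. by rewrite /cross !mxE; ring. Qed.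

(** Twice the Euclidean area. *)
Definition tri_area T : R := cross (apex T 1 - apex T 0) (apex T 2%:R - apex T 1).

(* [wt T k] is the barycentric coordinate at the [k]-th apex, and [dwt T k] its
   linear part. *)
Definition dwt T k h : R :=
  cross (apex T (k + 2%:R) - apex T (k + 1)) h / tri_area T.

Definition wt T k x : R := dwt T k (x - apex T (k + 1)).

Lemma wtD T k x h : wt T k (x + h) = wt T k x + dwt T k h.
Proof. by rewrite /wt addrAC /dwt (crossDr _ (x - _)) mulrDl. Qed.

Lemma dwtN T k h : dwt T k (- h) = - dwt T k h.
Proof. by rewrite /dwt -mulNr; congr (_ / _); rewrite /cross !mxE; ring. Qed.

Lemma dwtZ T k a h : dwt T k (a *: h) = a * dwt T k h.
Proof. by rewrite /dwt crossZr mulrA. Qed.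

Lemma tri_area_neq0 T : tri_area T != 0.
Proof. by rewrite gt_eqF ?apex_ccw. Qed.

Lemma plane_eqP (u v : plane R) : u 0 0 = v 0 0 -> u 0 1 = v 0 1 -> u = v.
Proof.
move=> uv0 uv1; apply/rowP=> -[[|[|//]] lt_k2].
  by rewrite (_ : Ordinal lt_k2 = 0) //; apply: val_inj.
by rewrite (_ : Ordinal lt_k2 = 1) //; apply: val_inj.
Qed.

Let add3E : (((0 + 1)%R = 1 :> 'I_3) * ((0 + 2%:R)%R = 2%:R :> 'I_3) *
  ((1 + 1)%R = 2%:R :> 'I_3) * ((1 + 2%:R)%R = 0 :> 'I_3) *
  ((2%:R + 1)%R = 0 :> 'I_3) * ((2%:R + 2%:R)%R = 1 :> 'I_3))%type.
Proof. by split; [split; [split; [split; [split|]|]|]|]; apply: val_inj. Qed.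

Lemma wt_sum T x : \sum_k wt T k x = 1.
Proof.
have := tri_area_neq0 T; rewrite sum_ord3 /wt /dwt !add3E /tri_area.
by rewrite /cross !mxE => ?; field.
Qed.

Lemma wt_bary T x : \sum_k wt T k x *: apex T k = x.
Proof.
have := tri_area_neq0 T; rewrite sum_ord3 /wt /dwt !add3E /tri_area => A0.
by apply: plane_eqP; move: A0; rewrite /cross !mxE => ?; field.
Qed.

Lemma wt_comb T (a : 'I_3 -> R) k :
  \sum_l a l = 1 -> wt T k (\sum_l a l *: apex T l) = a k.
Proof.
have := tri_area_neq0 T; rewrite !sum_ord3 /wt /dwt /tri_area => A0.
(* The condition on the sum is solved for [a 0], which is then substituted so that [field]
   applies. *)
move=> /(canRL (addrK _)) /(canRL (addrK _)).
case: (ord3P k) => ->; rewrite !add3E; move: A0; rewrite /cross !mxE => A0 ->.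
- by field.
- by field.
- by field.
Qed.

Lemma regionP T x :
  region (triangle_figure T) x <-> forall k, 0 <= wt T k x.
Proof.
split=> [[a [a_ge0 a1 ->] k]|wt_ge0]; first by rewrite wt_comb.
by exists (wt T ^~ x); rewrite wt_sum wt_bary.
Qed.

Lemma wt_apex T k l : wt T k (apex T l) = (k == l)%:R.
Proof.
rewrite -(_ : \sum_m (m == l)%:R *: apex T m = apex T l).
  rewrite wt_comb // (bigD1 l) //= eqxx big1 ?addr0 // => m /negPf -> //.
rewrite (bigD1 l) //= eqxx scale1r big1 ?addr0 // => m /negPf -> //.
by rewrite scale0r.
Qed.

End Barycentric.

Lemma ord3_cases (k l : 'I_3) : [\/ l = k, l = k + 1 | l = k + 2%:R].
Proof.
case: (ord3P k) => ->; case: (ord3P l) => ->;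
  by [apply: Or31; apply: val_inj | apply: Or32; apply: val_inj
     |apply: Or33; apply: val_inj].
Qed.

Lemma ord3_neq (k : 'I_3) : [/\ k + 1 != k, k + 2%:R != k & k + 2%:R != k + 1].
Proof. by case: (ord3P k) => ->. Qed.

Lemma sum_ord3_shift (W : nmodType) (k : 'I_3) (F : 'I_3 -> W) :
  \sum_l F l = F k + F (k + 1) + F (k + 2%:R).
Proof.
have [n1 n2 n3] := ord3_neq k.
rewrite (bigD1 k) //= (bigD1 (k + 1)) //= (bigD1 (k + 2%:R)) ?n2 ?n3 //=.
rewrite big1 ?addr0 => [|l]; first by rewrite [LHS]addrA.
by case: (ord3_cases k l) => ->; rewrite eqxx ?andbF.
Qed.

(** * Sides of a triangle and estimates for barycentric coordinates *)

Section TriangleSides.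
Variable R : realType.
Implicit Types (T : triangle R) (k l : 'I_3) (x h : plane R).

Local Notation tside T k := (@side R (triangle_figure T) k).

Lemma sideE T k : tside T k = apex T (k + 1) - apex T k.
Proof. by rewrite -ordS3E. Qed.

Lemma cross_side T k : cross (tside T k) (tside T (k + 1)) = tri_area T.
Proof.
rewrite !sideE /tri_area; case: (ord3P k) => ->.
- by rewrite add0r; congr (cross _ (apex T _ - _)); apply: val_inj.
- rewrite (_ : 1 + 1 = 2%:R) // (_ : 2%:R + 1 = 0 :> 'I_3); last exact: val_inj.
  by rewrite /cross !mxE; ring.
- rewrite (_ : 2%:R + 1 = 0 :> 'I_3); last exact: val_inj.
  by rewrite add0r /cross !mxE; ring.
Qed.

(** Distinct sides are consecutive in one order or the other, and the cross product of consecutive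
    sides is [tri_area T], which is not zero. *)
Lemma side_parallel T k l : cross (tside T k) (tside T l) = 0 -> k = l.
Proof.
have A0 := tri_area_neq0 T; case: (ord3_cases k l) => -> // kl0.
  by move: A0; rewrite -(cross_side T k) kl0 eqxx.
have := cross_side T (k + 2%:R); rewrite -(addrA k).
rewrite (_ : 2%:R + 1 = 0 :> 'I_3) ?addr0; last exact: val_inj.
move=> kl; move: A0; rewrite -kl.
suff -> : cross (tside T (k + 2%:R)) (tside T k)
  = - cross (tside T k) (tside T (k + 2%:R)) by rewrite kl0 oppr0 eqxx.
by rewrite /cross !mxE; ring.
Qed.

Lemma side_neq0 T k : tside T k != 0.
Proof.
apply/eqP => k0; have := tri_area_neq0 T; rewrite -(cross_side T k) k0.
by rewrite /cross !mxE !mul0r subrr eqxx.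
Qed.

Lemma side_neqN T k l : tside T k <> - tside T l.
Proof.
move=> klN; have kl : k = l.
  by apply: (@side_parallel T); rewrite klN /cross !mxE; ring.
have := side_neq0 T k; rewrite -kl in klN.
suff -> : tside T k = 0 by rewrite eqxx.
have /eqP : tside T k *+ 2 = 0 by rewrite mulr2n {1}klN addNr.
by rewrite -scaler_nat scaler_eq0 pnatr_eq0 /= => /eqP.
Qed.

(** The [k]-th side is opposite to the apex [k + 2%:R]; its point with parameter [t] has the
    coordinates [1 - t], [t] and [0]. *)
Lemma edgeP T k x :
  @edge R (triangle_figure T) k x <->
  region (triangle_figure T) x /\ wt T (k + 2%:R) x = 0.
Proof.
have [n1 n2 n3] := ord3_neq k.
split=> [[t /=]|[/regionP x_ge0 x0]].
  rewrite in_itv /= => /andP[t0 t1] <-.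
  pose a l := if l == k then 1 - t else if l == k + 1 then t else 0.
  have a1 : \sum_l a l = 1.
    by rewrite (sum_ord3_shift k) /a eqxx (negPf n1) (negPf n2) (negPf n3) eqxx;
      ring.
  have -> : apex T k + t *: tside T k = \sum_l a l *: apex T l.
    rewrite (sum_ord3_shift k) /a eqxx (negPf n1) (negPf n2) (negPf n3) eqxx.
    by rewrite sideE; apply: plane_eqP; rewrite !mxE; ring.
  rewrite wt_comb // {2}/a (negPf n2) (negPf n3); split => //.
  apply/regionP => l; rewrite wt_comb // /a.
  by case: ifP => _; [rewrite subr_ge0 | case: ifP].
have := wt_sum T x; rewrite (sum_ord3_shift k) x0 addr0 => xk.
exists (wt T (k + 1) x).
  by rewrite /= in_itv /= x_ge0 /= -xk lerDr x_ge0.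
rewrite -[RHS](wt_bary T) (sum_ord3_shift k) x0 scale0r addr0 /= sideE.
have -> : wt T k x = 1 - wt T (k + 1) x by rewrite -xk addrK.
by apply: plane_eqP; rewrite !mxE; ring.
Qed.

Lemma plane_norm_ge (x : plane R) j : `|x 0 j| <= `|x|.
Proof.
rewrite [leRHS]/Num.norm /= mx_normrE.
exact: (le_bigmax _ (fun ij : 'I_1 * 'I_2 => `|x ij.1 ij.2|) (0, j)).
Qed.

Lemma dwt_lipschitz T : exists2 C, 0 < C & forall k h, `|dwt T k h| <= C * `|h|.
Proof.
pose u k := apex T (k + 2%:R) - apex T (k + 1).
pose c k := (`|u k 0 0| + `|u k 0 1|) / tri_area T.
have A0 : 0 < tri_area T by apply: apex_ccw.
have c_ge0 k : 0 <= c k by apply: divr_ge0; [exact: addr_ge0 | exact: ltW].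
exists (1 + \sum_k c k) => [|k h]; first by rewrite ltr_pwDl ?sumr_ge0.
apply: (@le_trans _ _ (c k * `|h|)); last first.
  apply: ler_wpM2r => //; rewrite (bigD1 k) //= addrCA lerDl.
  by rewrite addr_ge0 ?sumr_ge0.
rewrite /dwt -/(u k) normrM normfV (gtr0_norm A0) mulrAC.
apply: ler_wpM2r; first by rewrite invr_ge0 ltW.
rewrite mulrDl; apply: (le_trans (ler_normB _ _)); rewrite !normrM.
by rewrite lerD // ler_wpM2l // plane_norm_ge.
Qed.

(** Every point has a barycentric coordinate that is at least [1 / 3%:R]; after a shift by such an
    [h] it is still positive. *)
Lemma dwt_small T : exists2 r, 0 < r &
  forall k h, `|h| < r -> `|dwt T k h| < 1 / 3%:R.
Proof.
have [C C0 lip] := dwt_lipschitz T; exists (1 / 3%:R / C) => [|k h].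
  by rewrite !divr_gt0.
by rewrite ltr_pdivlMr // mulrC; apply: le_lt_trans.
Qed.

Lemma region_convex T x y t : region (triangle_figure T) x ->
  region (triangle_figure T) y -> 0 <= t <= 1 ->
  region (triangle_figure T) (x + t *: (y - x)).
Proof.
move=> /regionP x_ge0 /regionP y_ge0 /andP[t0 t1]; apply/regionP => k.
rewrite wtD dwtZ; have := wtD T k x (y - x); rewrite addrC subrK => /eqP.
rewrite addrC -subr_eq => /eqP <-.
have -> : wt T k x + t * (wt T k y - wt T k x)
  = (1 - t) * wt T k x + t * wt T k y by ring.
by rewrite addr_ge0 // mulr_ge0 // subr_ge0.
Qed.

Lemma apex_region T k : region (triangle_figure T) (apex T k).
Proof. by apply/regionP => l; rewrite wt_apex. Qed.

Lemma wt_le1 T k x : region (triangle_figure T) x -> wt T k x <= 1.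
Proof.
move=> /regionP x_ge0; rewrite -(wt_sum T x) (bigD1 k) //= lerDl.
by rewrite sumr_ge0.
Qed.

Lemma region_compact T : compact (region (triangle_figure T)).
Proof.
apply: bounded_closed_compact.
  exists (\sum_k `|apex T k|); split; first by rewrite num_real.
  move=> M /ltW leM x xT; apply: le_trans leM; rewrite -{1}(wt_bary T x).
  apply: (le_trans (ler_norm_sum _ _ _)); apply: ler_sum => k _.
  rewrite normrZ ler_piMl // ger0_norm ?wt_le1 //.
  by move/regionP: xT.
have -> : region (triangle_figure T) = \bigcap_k [set x | 0 <= wt T k x].
  apply/seteqP; split=> x; first by move=> /regionP xT k _; apply: xT.
  by move=> xT; apply/regionP => k; apply: xT.
apply: closed_bigI => k _.
have [C C0 lip] := dwt_lipschitz T.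
rewrite -[X in closed X]setCK; apply: open_closedC; rewrite openE => x /= /negP.
rewrite -ltNge => x0; apply/nbhs_ballP; exists (- wt T k x / C).
  by rewrite /= divr_gt0 ?oppr_gt0.
move=> y; rewrite -ball_normE /= => xy; apply/negP; rewrite -ltNge.
rewrite -[y](subrK x) addrC wtD -ltrBrDl sub0r.
apply: le_lt_trans (ler_norm _) _; apply: (le_lt_trans (lip _ _)).
by rewrite mulrC -ltr_pdivlMr // distrC.
Qed.


End TriangleSides.

(** * Glued triangles *)

Section Gluing.
Variables (R : realType) (n : nat) (T : 'I_n -> triangle R).
Local Notation P := (@triangle_figure R \o T).
Variable g : gluing P.
Implicit Types (x y : plane R) (e : side_index P) (i j : 'I_n) (k l : 'I_3).

Definition hside i k : side_index P := existT _ i (k : 'I_(nb_sides (P i))).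
Definition hs_tri e : 'I_n := tag e.
Definition hs_idx e : 'I_3 := tagged e.

Lemma hsideE e : e = hside (hs_tri e) (hs_idx e).
Proof. by case: e. Qed.

(** By [mate_side], the same vector carries the end of [e] to the start of its mate
    ([apexS_shift]). *)
Definition shift e : plane R :=
  apex (T (hs_tri (mate g e))) (hs_idx (mate g e) + 1)
  - apex (T (hs_tri e)) (hs_idx e).

Lemma mate_sideE e :
  apex (T (hs_tri (mate g e))) (hs_idx (mate g e) + 1)
  - apex (T (hs_tri (mate g e))) (hs_idx (mate g e))
  = apex (T (hs_tri e)) (hs_idx e) - apex (T (hs_tri e)) (hs_idx e + 1).
Proof.
have : @side R (triangle_figure (T (hs_tri (mate g e)))) (hs_idx (mate g e))
  = - @side R (triangle_figure (T (hs_tri e))) (hs_idx e) := mate_side g e.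
by rewrite !sideE opprB.
Qed.

Lemma shift_mate e : shift (mate g e) = - shift e.
Proof.
rewrite /shift mateK opprB; have /eqP := mate_sideE e.
rewrite subr_eq => /eqP ->.
by apply: plane_eqP; rewrite !mxE; ring.
Qed.

Lemma glue_stepP a b : glue_step g a b <->
  exists e, [/\ a.1 = hs_tri e, region (triangle_figure (T (hs_tri e))) a.2,
    wt (T (hs_tri e)) (hs_idx e + 2%:R) a.2 = 0 &
    b = (hs_tri (mate g e), a.2 + shift e)].
Proof.
split=> [[e x /edgeP[xT x0]]|].
  by exists e; split=> //=; rewrite /shift -ordS3E.
case: a => i x [e [/= -> xT x0 ->]]; rewrite /shift -ordS3E.
by apply: (@GlueStep R n P g e x); apply/(@edgeP R (T (hs_tri e))).
Qed.

(** The gluing maps a side affinely onto its mate and reverses it, so the coordinates at the two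
    ends are exchanged. *)
Lemma mate_wt e x : wt (T (hs_tri e)) (hs_idx e + 2%:R) x = 0 ->
  [/\ wt (T (hs_tri (mate g e))) (hs_idx (mate g e)) (x + shift e)
      = wt (T (hs_tri e)) (hs_idx e + 1) x,
      wt (T (hs_tri (mate g e))) (hs_idx (mate g e) + 1) (x + shift e)
      = wt (T (hs_tri e)) (hs_idx e) x &
      wt (T (hs_tri (mate g e))) (hs_idx (mate g e) + 2%:R) (x + shift e) = 0].
Proof.
set T1 := T (hs_tri e); set k := hs_idx e.
set T2 := T (hs_tri (mate g e)); set k' := hs_idx (mate g e) => x0.
have [n1 n2 n3] := ord3_neq k'.
pose a l := if l == k' then wt T1 (k + 1) x else
  if l == k' + 1 then wt T1 k x else 0.
have := wt_sum T1 x; rewrite (sum_ord3_shift k) x0 addr0 => x1.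
have a1 : \sum_l a l = 1.
  rewrite (sum_ord3_shift k') /a !eqxx (negPf n1) (negPf n2) (negPf n3).
  by rewrite addr0 addrC.
suff -> : x + shift e = \sum_l a l *: apex T2 l.
  by rewrite !wt_comb // /a !eqxx (negPf n1) (negPf n2) (negPf n3).
rewrite (sum_ord3_shift k') /a !eqxx (negPf n1) (negPf n2) (negPf n3).
rewrite -{1}(wt_bary T1 x) (sum_ord3_shift k) x0 !scale0r !addr0 /shift.
rewrite -/T1 -/T2 -/k -/k'; have /eqP := mate_sideE e.
rewrite -/T1 -/T2 -/k -/k' subr_eq => /eqP ->.
have -> : wt T1 k x = 1 - wt T1 (k + 1) x by rewrite -x1 addrK.
by apply: plane_eqP; rewrite !mxE; ring.
Qed.

Lemma glue_step_sym a b : glue_step g a b -> glue_step g b a.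
Proof.
move=> /glue_stepP[e [ae aT a0 ->]]; apply/glue_stepP; exists (mate g e).
have [w1 w2 w3] := mate_wt a0; split => //=; last first.
  by rewrite mateK shift_mate addrK -ae; case: (a).
apply/regionP => l; move/regionP: aT => a_ge0.
by case: (ord3_cases (hs_idx (mate g e)) l) => ->; rewrite ?w1 ?w2 ?w3.
Qed.

(** As [glue_step] is symmetric, invariance under forward steps suffices. *)
Lemma glue_ind (Q : 'I_n * plane R -> Prop) a b :
  (forall a b, glue_step g a b -> Q a -> Q b) ->
  clos_refl_sym_trans _ (glue_step g) a b -> Q a -> Q b.
Proof.
move=> stepQ ab; suff [] : (Q a -> Q b) /\ (Q b -> Q a) by [].
elim: ab => {a b} [a b ab|a|a b _ [ab ba]|a b c _ [ab ba] _ [bc cb]].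
- by split; apply: stepQ => //; apply: glue_step_sym.
- by [].
- by [].
- by split=> [/ab|/cb]; [apply: bc | apply: ba].
Qed.

Variables (S : topologicalType) (phi : 'I_n -> plane R -> S).
Hypothesis asm : assembled g phi.

Definition chart_rep (p : S) i x := region (triangle_figure (T i)) x /\ phi i x = p.

Lemma rep_glued p i x j y : chart_rep p i x -> chart_rep p j y ->
  clos_refl_sym_trans _ (glue_step g) (i, x) (j, y).
Proof. by case: asm => _ glueP _ [xT <-] [yT yp]; apply/glueP. Qed.

Lemma rep_exists p : exists i x, chart_rep p i x.
Proof. by case: asm => surj _ _; have [i [x xT <-]] := surj p; exists i, x. Qed.

Lemma mate_rep p e x : chart_rep p (hs_tri e) x ->
  wt (T (hs_tri e)) (hs_idx e + 2%:R) x = 0 ->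
  chart_rep p (hs_tri (mate g e)) (x + shift e).
Proof.
move=> [xT <-] x0.
have st : glue_step g (hs_tri e, x) (hs_tri (mate g e), x + shift e).
  by apply/glue_stepP; exists e.
have x'r : region (triangle_figure (T (hs_tri (mate g e)))) (x + shift e).
  have [w1 w2 w3] := mate_wt x0; apply/regionP => l; move/regionP: xT => a_ge0.
  by case: (ord3_cases (hs_idx (mate g e)) l) => ->; rewrite ?w1 ?w2 ?w3.
split=> //; apply/esym; case: asm => _ glueP _; apply/glueP => //.
exact: rst_step.
Qed.

Lemma apex_shift e :
  apex (T (hs_tri e)) (hs_idx e) + shift e
  = apex (T (hs_tri (mate g e))) (hs_idx (mate g e) + 1).
Proof. by rewrite /shift addrC subrK. Qed.

Lemma apexS_shift e :
  apex (T (hs_tri e)) (hs_idx e + 1) + shift e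
  = apex (T (hs_tri (mate g e))) (hs_idx (mate g e)).
Proof.
rewrite /shift; have /eqP := mate_sideE e; rewrite subr_eq => /eqP ->.
by apply: plane_eqP; rewrite !mxE; ring.
Qed.

Lemma apex_mate e :
  phi (hs_tri (mate g e)) (apex (T (hs_tri (mate g e))) (hs_idx (mate g e) + 1))
  = phi (hs_tri e) (apex (T (hs_tri e)) (hs_idx e)).
Proof.
rewrite -apex_shift; apply: (proj2 (@mate_rep _ e _ _ _)) => //.
  by split=> //; apply: apex_region.
by have [_ n2 _] := ord3_neq (hs_idx e); rewrite wt_apex (negPf n2).
Qed.

Lemma apexS_mate e :
  phi (hs_tri (mate g e)) (apex (T (hs_tri (mate g e))) (hs_idx (mate g e)))
  = phi (hs_tri e) (apex (T (hs_tri e)) (hs_idx e + 1)).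
Proof.
rewrite -apexS_shift; apply: (proj2 (@mate_rep _ e _ _ _)) => //.
  by split=> //; apply: apex_region.
by have [_ _ n3] := ord3_neq (hs_idx e); rewrite wt_apex (negPf n3).
Qed.

(** A gluing step exchanges the ends of an edge and keeps displacements and weights. The corner
    opposite to the edge has weight zero there, so the positive weight excludes it. *)
Lemma corner_transfer p i x j y k : chart_rep p i x -> chart_rep p j y ->
  0 < wt (T i) k x -> exists l,
  [/\ apex (T j) l - y = apex (T i) k - x, wt (T j) l y = wt (T i) k x &
      phi j (apex (T j) l) = phi i (apex (T i) k)].
Proof.
move=> xp yp xk.
pose Q (b : 'I_n * plane R) := exists l,
  [/\ apex (T b.1) l - b.2 = apex (T i) k - x, wt (T b.1) l b.2 = wt (T i) k x &
      phi b.1 (apex (T b.1) l) = phi i (apex (T i) k)].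
apply: (@glue_ind Q (i, x) (j, y) _ (rep_glued xp yp)); last by exists k.
move=> [i1 x1] b /glue_stepP[e [/= -> x1T x10 ->]] [l [/= a1 a2 a3]].
have xl : 0 < wt (T (hs_tri e)) l x1 by rewrite a2.
have [w1 w2 w3] := mate_wt x10.
case: (ord3_cases (hs_idx e) l) => le; rewrite le in a1 a2 a3 xl.
- exists (hs_idx (mate g e) + 1) => /=; rewrite -a1 w2 apex_mate; split=> //.
  by rewrite -apex_shift opprD addrACA subrr addr0.
- exists (hs_idx (mate g e)) => /=; rewrite -a1 w1 apexS_mate; split=> //.
  by rewrite -apexS_shift opprD addrACA subrr addr0.
- by rewrite x10 ltxx in xl.
Qed.

Lemma interior_rep_uniq p i x j y : (forall k, 0 < wt (T i) k x) ->
  chart_rep p i x -> chart_rep p j y -> (j, y) = (i, x).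
Proof.
move=> x_gt0 xp yp.
apply: (@glue_ind (fun b => b = (i, x)) (i, x) (j, y) _ (rep_glued xp yp)) => //.
move=> a b /glue_stepP[e [ae _ a0 _]] ax; rewrite ax /= in ae a0.
by have := x_gt0 (hs_idx e + 2%:R); rewrite ae a0 ltxx.
Qed.

(** The two listed representatives are closed under gluing steps: with both end weights positive, a
    point lies on no other side of its triangle. *)
Lemma edge_rep p e x j y : wt (T (hs_tri e)) (hs_idx e + 2%:R) x = 0 ->
  0 < wt (T (hs_tri e)) (hs_idx e) x -> 0 < wt (T (hs_tri e)) (hs_idx e + 1) x ->
  chart_rep p (hs_tri e) x -> chart_rep p j y ->
  (j, y) = (hs_tri e, x) \/ (j, y) = (hs_tri (mate g e), x + shift e).
Proof.
move=> x2 x0 x1 xp yp.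
apply: (@glue_ind (fun b => b = (hs_tri e, x) \/
  b = (hs_tri (mate g e), x + shift e)) (hs_tri e, x) (j, y) _ (rep_glued xp yp));
  last by left.
have only_edge e1 e2 y1 : hs_tri e2 = hs_tri e1 ->
    0 < wt (T (hs_tri e1)) (hs_idx e1) y1 ->
    0 < wt (T (hs_tri e1)) (hs_idx e1 + 1) y1 ->
    wt (T (hs_tri e2)) (hs_idx e2 + 2%:R) y1 = 0 -> e2 = e1.
  move=> ee y10 y11; rewrite (hsideE e1) (hsideE e2) ee => y12.
  congr hside; apply: (addIr 2%:R).
  case: (ord3_cases (hs_idx e1) (hs_idx e2 + 2%:R)) => // ek.
    by rewrite ek in y12; rewrite y12 ltxx in y10.
  by rewrite ek in y12; rewrite y12 ltxx in y11.
have [w1 w2 w3] := mate_wt x2.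
move=> a b /glue_stepP[e1 [ae _ a0 ->]] [] ax; rewrite ax /= in ae a0 *.
  by have -> := only_edge e e1 x (esym ae) x0 x1 a0; right.
have -> := only_edge (mate g e) e1 _ (esym ae) _ _ a0; rewrite ?w1 ?w2 //.
by left; rewrite mateK shift_mate addrK.
Qed.

Lemma mate_tri_neq e : hs_tri (mate g e) <> hs_tri e.
Proof.
move=> ee; have : @side R (triangle_figure (T (hs_tri (mate g e)))) (hs_idx (mate g e))
  = - @side R (triangle_figure (T (hs_tri e))) (hs_idx e) := mate_side g e.
by rewrite ee => /side_neqN.
Qed.

End Gluing.

(** * Local comparison of two triangulations *)

Lemma common_radius (R : realType) (I : finType) (P : I -> R -> Prop) :
  (forall i r s, 0 < s -> s <= r -> P i r -> P i s) ->
  (forall i, exists2 r, 0 < r & P i r) -> exists2 r, 0 < r & forall i, P i r.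
Proof.
move=> Pmono Pex; suff [r r0 Pr] : exists2 r, 0 < r &
    forall i, i \in enum I -> P i r.
  by exists r => // i; apply: Pr; rewrite mem_enum.
elim: (enum I) => [|i s [r r0 Pr]]; first by exists 1.
have [ri ri0 Pi] := Pex i; exists (Num.min ri r); first by rewrite lt_min ri0.
move=> j; rewrite inE => /predU1P[->|/Pr Pj].
  by apply: Pmono Pi; rewrite ?lt_min ?ri0 // ge_min lexx.
by apply: Pmono Pj; rewrite ?lt_min ?ri0 // ge_min lexx orbT.
Qed.

Section AssembledTopology.
Variables (R : realType) (n : nat) (T : 'I_n -> triangle R).
Variable g : gluing (@triangle_figure R \o T).
Variables (S : topologicalType) (phi : 'I_n -> plane R -> S).
Hypothesis asm : assembled g phi.
Implicit Types (x y z : plane R) (i : 'I_n).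

Local Notation dom i := (region (triangle_figure (T i))).

Lemma region_closed i : closed (dom i).
Proof.
by apply: compact_closed; [exact: norm_hausdorff | exact: region_compact].
Qed.

Lemma avoid_closed A i x : closed A -> dom i x -> ~ A (phi i x) ->
  exists2 r, 0 < r & forall z, dom i z -> `|z - x| < r -> ~ A (phi i z).
Proof.
case: asm => _ _ closedE /closedE/(_ i) /closed_openC + xT Ax.
rewrite openE => /(_ x) nbx; have : (~` (dom i `&` phi i @^-1` A)) x by case.
move=> /nbx/nbhs_ballP[r /= r0 rP].
exists r => // z zT zx Az; apply: (rP z) => //.
by rewrite -ball_normE /= distrC.
Qed.

Lemma image_closed i B : hausdorff_space S -> closed B -> B `<=` dom i ->
  closed (phi i @` B).
Proof.
move=> hS cB BT; apply: compact_closed => //; apply: continuous_compact; last first.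
  exact: (subclosed_compact cB (@region_compact R (T i)) BT).
apply/continuous_closedP => A cA; apply/closed_subspaceP.
exists (dom i `&` phi i @^-1` A).
  by case: asm => _ _ closedE; exact: (closedE A).1.
by apply/seteqP; split=> [z [[_ Az] Bz]|z [Az Bz]]; split=> //; split=> //; apply: BT.
Qed.

End AssembledTopology.

Section NearbyReps.
Variables (R : realType) (S : topologicalType) (hS : hausdorff_space S).
Variables (n n' : nat) (T : 'I_n -> triangle R) (T' : 'I_n' -> triangle R).
Variables (g : gluing (@triangle_figure R \o T)).
Variables (g' : gluing (@triangle_figure R \o T')).
Variables (phi : 'I_n -> plane R -> S) (phi' : 'I_n' -> plane R -> S).
Hypotheses (asm : assembled g phi) (asm' : assembled g' phi').

(** The points of the [j]-th triangle outside the discs about the coordinates of [phi i x] form a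
    compact set. Its image is closed and misses [phi i x], so it is avoided near [x]. *)
Lemma rep_near (rho : 'I_n' -> plane R -> R) i x :
  (forall j y, 0 < rho j y) -> region (triangle_figure (T i)) x ->
  exists2 r, 0 < r & forall z, region (triangle_figure (T i)) z -> `|z - x| < r ->
  forall j y, chart_rep T' phi' (phi i z) j y ->
  exists2 y0, chart_rep T' phi' (phi i x) j y0 & `|y - y0| < rho j y0.
Proof.
move=> rho0 xT; suff [r r0 rP] : exists2 r, 0 < r & forall j z,
    region (triangle_figure (T i)) z -> `|z - x| < r ->
    forall y, chart_rep T' phi' (phi i z) j y ->
    exists2 y0, chart_rep T' phi' (phi i x) j y0 & `|y - y0| < rho j y0.
  by exists r => // z zT zx j y; apply: rP.
apply: common_radius => [j r s s0 sr rP z zT zx|j].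
  by apply: rP => //; apply: lt_le_trans sr.
pose O := \bigcup_(y0 in chart_rep T' phi' (phi i x) j) ball y0 (rho j y0).
pose B := region (triangle_figure (T' j)) `&` ~` O.
have cB : closed B.
  apply: closedI; first exact: region_closed.
  by apply: open_closedC; apply: bigcup_open => y0 _; exact: ball_open.
have cA := image_closed asm' hS cB (@subIsetl _ _ _).
have [|r r0 rP] := avoid_closed asm cA xT.
  move=> [y [yT Oy] yx]; apply: Oy; exists y; first by split.
  exact: ballxx.
exists r => // z zT zx y [yT yz]; have := rP z zT zx.
move=> nA; have : O y.
  by apply: contrapT => Oy; apply: nA; exists y.
case=> y0 y0x; rewrite -ball_normE /= distrC => yy0; by exists y0.
Qed.

End NearbyReps.

(** The set where [Q] holds is open and closed in a connected interval. The end [1] is left out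
    because a sliding point will reach a singular point there. *)
Lemma unit_interval_locally_constant (R : realType) (Q : R -> Prop) : Q 0 ->
  (forall t, 0 <= t < 1 -> exists2 e, 0 < e &
     forall s, 0 <= s < 1 -> `|t - s| < e -> Q t <-> Q s) ->
  forall t, 0 <= t < 1 -> Q t.
Proof.
move=> Q0 Qloc; have : forall t, exists e, 0 <= t < 1 ->
    0 < e /\ forall s, 0 <= s < 1 -> `|t - s| < e -> Q t <-> Q s.
  by move=> t; have [/Qloc[e e0 eP]|_] := boolP (0 <= t < 1); [exists e | exists 0].
move=> /choice[e eP].
have itv_conn : connected [set t : R | 0 <= t < 1].
  apply/connected_intervalP => x y /= /andP[x0 _] /andP[_ y1] t /andP[xt ty].
  by rewrite (le_trans x0 xt) (le_lt_trans ty y1).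
pose U (P : R -> Prop) := \bigcup_(t in [set t : R | 0 <= t < 1 /\ P t]) ball t (e t).
have oU P : open (U P) by apply: bigcup_open => t _; apply: ball_open.
have inU (P : R -> Prop) s : 0 <= s < 1 -> P s -> U P s.
  by move=> s01 Ps; exists s => //; apply: ballxx; case: (eP s s01).
have : [set t : R | 0 <= t < 1 /\ Q t] = [set t | 0 <= t < 1].
  apply: itv_conn.
  - by exists 0; split=> //=; rewrite lexx ltr01.
  - exists (U Q) => //; apply/seteqP; split=> [t [t01 Qt]|t [t01 [s [s01 Qs] st]]].
      by split=> //; apply: inU.
    by split=> //; apply/((eP s s01).2 t t01).
  - exists (~` U (fun t => ~ Q t)); first exact: open_closedC.
    apply/seteqP; split=> [t [t01 Qt]|t [t01 Ut]]; split=> //.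
      move=> [s [s01 Qs] st]; apply: Qs.
      by apply/((eP s s01).2 t t01).
    by apply: contrapT => Qt; apply: Ut; apply: inU.
by move=> QE t t01; have [] : [set t : R | 0 <= t < 1 /\ Q t] t by rewrite QE.
Qed.

Section FlatTriangulation.
Variables (R : realType) (S : translation_surface R).
Variables (n : nat) (T : 'I_n -> triangle R).
Variable (g : gluing (@triangle_figure R \o T)) (phi : 'I_n -> plane R -> S).

Definition flat_triangulation :=
  [/\ assembled g phi,
      forall U psi, flat_chart U psi -> forall i, translation_compatible
        (region (triangle_figure (T i))) (phi i) U psi &
      forall p : S, singular p -> exists i k, p = phi i (apex (T i) k)].

Hypothesis triT : flat_triangulation.

(** One representative is an apex by hypothesis; [corner_transfer] carries this apex, with
    displacement zero, to all the others. *)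
Lemma singular_rep p i x : singular p -> chart_rep T phi p i x ->
  exists k, x = apex (T i) k.
Proof.
case: triT => asm _ sing /sing[j [k ->]] xp.
have jk : chart_rep T phi (phi j (apex (T j) k)) j (apex (T j) k).
  by split=> //; apply: apex_region.
have [|l [lx _ _]] := corner_transfer asm (k := k) jk xp.
  by rewrite wt_apex eqxx.
by exists l; apply/eqP; rewrite -subr_eq0 -opprB lx subrr oppr0.
Qed.

Lemma chart_radius U psi i x u : @flat_chart R S U psi ->
  region (triangle_figure (T i)) x -> U u -> phi i x = psi u ->
  exists2 r, 0 < r & forall h, `|h| < r ->
    region (triangle_figure (T i)) (x + h) -> U (u + h) /\ phi i (x + h) = psi (u + h).
Proof.
case: triT => asm compat _ Upsi xT Uu xu.
have /nbhs_ballP[r1 /= r10 r1P] := compat _ _ Upsi i x u xT Uu xu.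
have Uo : open U by case: Upsi.
have /nbhs_ballP[r2 /= r20 r2P] : nbhs u U by apply: open_nbhs_nbhs.
exists (Num.min r1 r2) => [|h]; first by rewrite lt_min r10.
rewrite lt_min => /andP[h1 h2] xhT; split.
  by apply: r2P; rewrite -ball_normE /= opprD addrA subrr add0r normrN.
by apply: r1P => //; rewrite -ball_normE /= sub0r normrN.
Qed.

End FlatTriangulation.

Section LocalTranslation.
Variables (R : realType) (S : translation_surface R).
Variables (n n' : nat) (T : 'I_n -> triangle R) (T' : 'I_n' -> triangle R).
Variables (g : gluing (@triangle_figure R \o T)).
Variables (g' : gluing (@triangle_figure R \o T')).
Variables (phi : 'I_n -> plane R -> S) (phi' : 'I_n' -> plane R -> S).
Hypotheses (triT : flat_triangulation g phi) (triT' : flat_triangulation g' phi').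

Let asm : assembled g phi. Proof. by case: triT. Qed.
Let asm' : assembled g' phi'. Proof. by case: triT'. Qed.
Let hS : hausdorff_space S. Proof. exact: ts_hausdorff. Qed.

(** A flat chart about the point reads both triangulations by translations and is injective, so the
    two displacements are equal. *)
Let regular_translation i x : region (triangle_figure (T i)) x ->
  ~ singular (phi i x) ->
  exists2 r, 0 < r & forall z, region (triangle_figure (T i)) z -> `|z - x| < r ->
  forall j y, chart_rep T' phi' (phi i z) j y ->
              chart_rep T' phi' (phi i x) j (y - (z - x)).
Proof.
move=> xT /contrapT[U [psi [Upsi [u Uu ux]]]].
(* A radius is chosen for every pair, with the idle value [1] where [y] is not a coordinate of the
   point, because [rep_near] takes a total function. *)
have : forall jy : 'I_n' * plane R, exists rho, 0 < rho /\
    (chart_rep T' phi' (phi i x) jy.1 jy.2 -> forall h, `|h| < rho ->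
     region (triangle_figure (T' jy.1)) (jy.2 + h) ->
     U (u + h) /\ phi' jy.1 (jy.2 + h) = psi (u + h)).
  case=> j y /=; have [[yT yx]|nrep] := pselect (chart_rep T' phi' (phi i x) j y).
    have [|r r0 rP] := chart_radius triT' Upsi yT Uu; first by rewrite yx.
    by exists r; split.
  by exists 1; split.
move=> /choice[rho rhoP].
have [|r1 r10 r1P] := rep_near hS asm asm' (rho := fun j y => rho (j, y)) _ xT.
  by move=> j y; case: (rhoP (j, y)).
have [r2 r20 r2P] := chart_radius triT Upsi xT Uu (esym ux).
exists (Num.min r1 r2) => [|z zT]; first by rewrite lt_min r10.
rewrite lt_min => /andP[zx1 zx2] j y yz.
have [y0 y0x yy0] := r1P z zT zx1 j y yz.
have [|Uz] := r2P (z - x) zx2; rewrite addrC subrK // => zE.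
have [/= _ /(_ y0x (y - y0) yy0)] := rhoP (j, y0).
rewrite addrC subrK => -[|Uy yE]; first by case: yz.
case: Upsi => _ _ psi_inj _ _.
have : u + (z - x) = u + (y - y0).
  apply: psi_inj; [exact/mem_set | exact/mem_set |].
  by rewrite -zE -yE; case: yz.
by move=> /addrI ->; rewrite subKr.
Qed.

Lemma wt_gt13_uniq i x k l : region (triangle_figure (T' i)) x ->
  2%:R / 3%:R < wt (T' i) k x -> 1 / 3%:R < wt (T' i) l x -> k = l.
Proof.
move=> /regionP x_ge0 xk xl; apply/eqP; apply: contraT => kl.
have := wt_sum (T' i) x; rewrite (bigD1 k) //= (bigD1 l) 1?eq_sym //=.
have : 0 <= \sum_(m | (m != k) && (m != l)) wt (T' i) m x by rewrite sumr_ge0.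
lra.
Qed.

(* Near a cone point no chart is available. There [x] is an apex, and one slides
   [z] along a segment towards [x]: the points met on the way are regular, so
   the position relative to an apex of [T'] over [phi i x] is translated along,
   and it must vanish at the end of the segment. *)
Lemma local_translation i x : region (triangle_figure (T i)) x ->
  exists2 r, 0 < r & forall z, region (triangle_figure (T i)) z -> `|z - x| < r ->
  forall j y, chart_rep T' phi' (phi i z) j y ->
              chart_rep T' phi' (phi i x) j (y - (z - x)).
Proof.
move=> xT; have [sx|] := pselect (singular (phi i x)); last exact: regular_translation.
have [kx xE] : exists k, x = apex (T i) k by apply: (singular_rep triT sx).
have [r1 r10 r1P] : exists2 r, 0 < r & forall j k h, `|h| < r ->
    `|dwt (T' j) k h| < 1 / 3%:R.
  apply: common_radius => [j r s _ sr rP k h hs|j]; last exact: dwt_small.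
  by apply: rP; apply: lt_le_trans sr.
have [r2 r20 r2P] := dwt_small (T i).
have [|r3 r30 r3P] := rep_near hS asm asm' (rho := fun _ _ => r1 / 2%:R) _ xT.
  by move=> _ _; rewrite divr_gt0.
have r12 : 0 < r1 / 2%:R by rewrite divr_gt0.
exists (Num.min (r1 / 2%:R) (Num.min r2 r3)) => [|z zT].
  by rewrite !lt_min r12 r20.
rewrite !lt_min => /and3P[zx1 zx2 zx3] j y yz.
have [y0 y0x yy0] := r3P z zT zx3 j y yz.
have [k y0E] := singular_rep triT' sx y0x.
have [zx|zx] := eqVneq z x; first by rewrite zx subrr subr0 -zx.
have {}zx : 0 < `|x - z| by rewrite normr_gt0 subr_eq0 eq_sym.
rewrite distrC in zx1; rewrite distrC in zx2.
(* [w t] is the expected offset of the coordinate of [zt t] in [T'] from an apex over [phi i x]; the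
   goal amounts to [w 1 = 0]. *)
pose zt t := z + t *: (x - z); pose w t := (y - y0) + t *: (x - z).
have ztT t : 0 <= t < 1 -> region (triangle_figure (T i)) (zt t).
  by move=> /andP[t0 t1]; apply: region_convex => //; rewrite t0 ltW.
(* Within [r2] of [x] the weight at [kx] exceeds two thirds, so no other apex is met, and [x] is
   reached only at [t = 1]. *)
have zt_reg t : 0 <= t < 1 -> ~ singular (phi i (zt t)).
  move=> t01 st; have /andP[t0 t1] := t01.
  have [l ztE] : exists l, zt t = apex (T i) l.
    by apply: (singular_rep triT st); split=> //; exact: ztT.
  have ztx : zt t = x + (1 - t) *: (z - x).
    by rewrite /zt; apply: plane_eqP; rewrite !mxE; ring.
  have small : `|(1 - t) *: (z - x)| < r2.
    rewrite normrZ ger0_norm ?subr_ge0 1?ltW // distrC.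
    by apply: le_lt_trans zx2; rewrite ler_piMl // gerBl.
  have := r2P kx _ small; rewrite ltr_norml => /andP[gt_dwt _].
  have := wtD (T i) kx x ((1 - t) *: (z - x)).
  rewrite -ztx ztE {1}xE !wt_apex eqxx.
  have [lk _|_ /= E] := eqVneq kx l; last by move: gt_dwt E; lra.
  move: ztx; rewrite ztE -lk -xE => /eqP; rewrite -subr_eq0 opprD addrA subrr add0r.
  rewrite oppr_eq0 scaler_eq0 subr_eq0 gt_eqF //= subr_eq0 => /eqP zxE.
  by rewrite zxE subrr normr0 ltxx in zx.
have w_small t : 0 <= t < 1 -> `|w t| < r1.
  move=> /andP[t0 t1]; apply: le_lt_trans (ler_normD _ _) _.
  rewrite [ltRHS](splitr r1) ltrD // normrZ ger0_norm //.
  by apply: le_lt_trans zx1; rewrite ler_piMl // ltW.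
(* The triangle [l] and its corner [m] may change along the path, when an edge of [T'] is
   crossed. *)
pose Q t := exists l m, phi' l (apex (T' l) m) = phi i x /\
  chart_rep T' phi' (phi i (zt t)) l (apex (T' l) m + w t).
have wt_big l m t : 0 <= t < 1 -> 2%:R / 3%:R < wt (T' l) m (apex (T' l) m + w t).
  move=> /w_small/(r1P l m); rewrite ltr_norml => /andP[gt_dwt _].
  by rewrite wtD wt_apex eqxx; move: gt_dwt => /=; lra.
have Qt : forall t, 0 <= t < 1 -> Q t.
  apply: unit_interval_locally_constant.
    exists j, k; rewrite -y0E; split; first by case: y0x.
    by rewrite /zt /w !scale0r !addr0 addrC subrK.
  move=> t t01; have [e e0 eP] := regular_translation (ztT t t01) (zt_reg t t01).
  exists (e / `|x - z|) => [|s s01 ts]; first exact: divr_gt0.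
  have ztB : zt s - zt t = (s - t) *: (x - z).
    by rewrite /zt; apply: plane_eqP; rewrite !mxE; ring.
  have zst : `|zt s - zt t| < e.
    by rewrite ztB normrZ -ltr_pdivlMr // distrC.
  have wB : w s - w t = zt s - zt t.
    by rewrite ztB /w; apply: plane_eqP; rewrite !mxE; ring.
  have wts : w s = w t + (zt s - zt t) by rewrite -wB addrC subrK.
  split=> [[l [m [mx lm]]]|[l [m [mx lm]]]]; last first.
    exists l, m; split=> //; have := eP _ (ztT s s01) zst _ _ lm.
    by rewrite wts addrA addrK.
  (* From [t] to [s]: an arbitrary representative at [s] is translated back to [t], and the apex [m]
     is transferred to its triangle. *)
  have [l' [y' y'z]] := rep_exists asm' (phi i (zt s)).
  have y'z0 := eP _ (ztT s s01) zst _ _ y'z.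
  have [|m' [m'E _ m'x]] := corner_transfer asm' (k := m) lm y'z0.
    by apply: lt_trans (wt_big l m t t01); lra.
  exists l', m'; split; first by rewrite m'x.
  suff <- : y' = apex (T' l') m' + w s by [].
  have /eqP : apex (T' l') m' - (y' - (zt s - zt t)) = - w t.
    by rewrite m'E opprD addrA subrr add0r.
  by rewrite subr_eq => /eqP ->; rewrite wts addrACA addNr add0r subrK.
(* If the final offset [v] were not zero, a point close to the end of the path would be within [eps]
   of an apex over [phi i x] by [rep_near]. The weights identify this apex as [m], so the offset
   there is shorter than half of [v], although it differs from [v] by less than that. *)
have w1 : (y - y0) + (x - z) = 0.
  apply/eqP; apply: contraT => w1_neq0; set v := _ + _ in w1_neq0.
  have v0 : 0 < `|v| by rewrite normr_gt0.
  pose eps := Num.min r1 (`|v| / 2%:R).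
  have eps0 : 0 < eps by rewrite lt_min r10 divr_gt0.
  have [//|r4 r40 r4P] := rep_near hS asm asm' (rho := fun _ _ => eps) _ xT.
  pose eta := Num.min 1 (Num.min r4 eps / `|x - z| / 2%:R).
  have eta0 : 0 < eta by rewrite !lt_min ltr01 !divr_gt0 // lt_min r40.
  have eta1 : eta <= 1 by rewrite ge_min lexx.
  have t01 : 0 <= 1 - eta < 1 by rewrite subr_ge0 eta1 gtrBl.
  have etax : eta * `|x - z| < Num.min r4 eps.
    rewrite -ltr_pdivlMr //;
    apply: (@le_lt_trans _ _ (Num.min r4 eps / `|x - z| / 2%:R)).
      by rewrite ge_min lexx orbT.
    have : 0 < Num.min r4 eps / `|x - z| by rewrite divr_gt0 // lt_min r40.
    lra.
  have [l [m [mx lm]]] := Qt _ t01.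
  have ztx : `|zt (1 - eta) - x| < r4.
    have -> : zt (1 - eta) - x = - (eta *: (x - z)).
      by rewrite /zt; apply: plane_eqP; rewrite !mxE; ring.
    rewrite normrN normrZ gtr0_norm //; apply: lt_le_trans etax _.
    by rewrite ge_min lexx.
  have [y1 y1x y1m] := r4P _ (ztT _ t01) ztx _ _ lm.
  have [m' y1E] := singular_rep triT' sx y1x.
  have lmT : region (triangle_figure (T' l)) (apex (T' l) m + w (1 - eta)) by case: lm.
  have mm' : m = m'.
    apply: (wt_gt13_uniq lmT); first exact: wt_big.
    have y1r : `|apex (T' l) m + w (1 - eta) - y1| < r1.
      by apply: lt_le_trans y1m _; rewrite ge_min lexx.
    have := r1P l m' _ y1r; rewrite ltr_norml => /andP[gt_dwt _].
    rewrite -[X in wt _ _ X](subrK y1) addrC wtD {1}y1E wt_apex eqxx /=.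
    by move: gt_dwt; lra.
  move: y1m; rewrite y1E -mm' addrAC subrr add0r => w_eps.
  have : `|v| < `|v|.
    have vE : v = w (1 - eta) + eta *: (x - z).
      by rewrite /v /w; apply: plane_eqP; rewrite !mxE; ring.
    rewrite {1}vE; apply: le_lt_trans (ler_normD _ _) _.
    rewrite [ltRHS](splitr `|v|) ltrD //.
      by apply: lt_le_trans w_eps _; rewrite ge_min lexx orbT.
    rewrite normrZ gtr0_norm //; apply: lt_le_trans etax _.
    by rewrite !ge_min lexx !orbT.
  by rewrite ltxx.
suff -> : y - (z - x) = y0 by [].
by move: w1 => /eqP; rewrite addr_eq0 opprB => /eqP <-; rewrite subKr.
Qed.

End LocalTranslation.

(** * Sums over midpoint subdivisions *)

Section GridSums.
Variable R : realType.
Implicit Types (p q r a b c : plane R).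

Definition mid p q : plane R := 2%:R^-1 *: (p + q).

Lemma midC p q : mid p q = mid q p. Proof. by rewrite /mid addrC. Qed.

Lemma midE p q : mid p q = p + 2%:R^-1 *: (q - p).
Proof. by apply: plane_eqP; rewrite !mxE; field. Qed.

Lemma midD p q c : mid (p + c) (q + c) = mid p q + c.
Proof. by apply: plane_eqP; rewrite !mxE; field. Qed.

Lemma mid_diff_l p q : p - mid p q = 2%:R^-1 *: (p - q).
Proof. by apply: plane_eqP; rewrite !mxE; field. Qed.

Lemma mid_diff p q r : mid p q - mid p r = 2%:R^-1 *: (q - r).
Proof. by apply: plane_eqP; rewrite !mxE; field. Qed.

(** All four halves are listed with the orientation of [p q r]; the middle one is a half-size point
    reflection of the triangle. *)
Fixpoint tsum (W : zmodType) m (G : plane R -> plane R -> plane R -> W) p q r : W :=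
  if m is m'.+1 then
    tsum m' G p (mid p q) (mid p r) + tsum m' G (mid p q) q (mid q r)
    + tsum m' G (mid p r) (mid q r) r + tsum m' G (mid q r) (mid p r) (mid p q)
  else G p q r.

Fixpoint esum (W : zmodType) m (E : plane R -> plane R -> W) p q : W :=
  if m is m'.+1 then esum m' E p (mid p q) + esum m' E (mid p q) q else E p q.

Section Sums.
Variable W : zmodType.
Implicit Types (G : plane R -> plane R -> plane R -> W) (E : plane R -> plane R -> W).

Lemma esum_anti m E p q : (forall a b, E b a = - E a b) ->
  esum m E q p = - esum m E p q.
Proof.
move=> EN; elim: m p q => [|m IHm] p q //=.
by rewrite (midC q p) opprD addrC (IHm p) (IHm _ q).
Qed.

(** Inner edges are traversed once in each direction and cancel. *)
Lemma tsum_boundary m E p q r : (forall a b, E b a = - E a b) ->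
  tsum m (fun a b c => E a b + E b c + E c a) p q r =
  esum m E p q + esum m E q r + esum m E r p.
Proof.
move=> EN; elim: m p q r => [|m IHm] p q r //=.
rewrite !IHm (midC r p).
rewrite (esum_anti m (mid p q) (mid p r)) // (esum_anti m (mid p q) (mid q r)) //.
rewrite (esum_anti m (mid p r) (mid q r)) //.
rewrite [LHS](AC (3*3*3*3) ((1*4)*(5*8)*(9*3)*((2*11)*(6*12)*(7*10)))) /=.
by rewrite subrr addNr subrr !addr0.
Qed.

(** Each subdivision halves the side lengths, so after [m] of them all triangles are smaller than
    [e]. *)
Lemma eq_tsum_small (D : plane R -> Prop) e m G G' p q r :
  (forall a b, D a -> D b -> D (mid a b)) ->
  (forall a b c, D a -> D b -> D c ->
     `|a - b| < e -> `|b - c| < e -> `|a - c| < e -> G a b c = G' a b c) ->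
  D p -> D q -> D r ->
  `|p - q| < 2%:R ^+ m * e -> `|q - r| < 2%:R ^+ m * e ->
  `|p - r| < 2%:R ^+ m * e ->
  tsum m G p q r = tsum m G' p q r.
Proof.
move=> Dmid GG'; elim: m p q r => [|m IHm] p q r Dp Dq Dr /=.
  by rewrite expr0 mul1r; apply: GG'.
rewrite exprS -mulrA => pq qr pr.
have half u : `|u| < 2%:R * (2%:R ^+ m * e) -> `|2%:R^-1 *: u| < 2%:R ^+ m * e.
  by move=> ue; rewrite normrZ ger0_norm ?invr_ge0 // mulrC ltr_pdivrMr // mulrC.
have corner a b : `|a - b| < 2%:R * (2%:R ^+ m * e) ->
    `|a - mid a b| < 2%:R ^+ m * e /\ `|mid a b - b| < 2%:R ^+ m * e.
  move=> ab; split; first by rewrite mid_diff_l half.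
  by rewrite distrC midC mid_diff_l half // distrC.
have middle a b c : `|a - b| < 2%:R * (2%:R ^+ m * e) ->
    `|mid a c - mid b c| < 2%:R ^+ m * e /\ `|mid b c - mid a c| < 2%:R ^+ m * e.
  by move=> ab; rewrite distrC; split; rewrite !(midC _ c) mid_diff half // distrC.
have [pq1 pq2] := corner _ _ pq; have [qr1 qr2] := corner _ _ qr.
have [pr1 pr2] := corner _ _ pr.
have [pq3 pq4] := middle _ _ r pq; have [qr3 qr4] := middle _ _ p qr.
have [pr3 pr4] := middle _ _ q pr.
rewrite !(midC _ p) in qr3 qr4; rewrite (midC r q) in pr3 pr4.
by congr (_ + _ + _ + _); apply: IHm => //; apply: Dmid.
Qed.

Lemma esum_translate (D : plane R -> Prop) c m E E' p q :
  (forall a b, D a -> D b -> D (mid a b)) ->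
  (forall a b, D a -> D b -> E' (a + c) (b + c) = E a b) ->
  D p -> D q -> esum m E' (p + c) (q + c) = esum m E p q.
Proof.
move=> Dmid EE'; elim: m p q => [|m IHm] p q Dp Dq /=; first exact: EE'.
by rewrite midD !IHm //; apply: Dmid.
Qed.

Lemma tsumD m G G' p q r :
  tsum m (fun a b c => G a b c + G' a b c) p q r =
  tsum m G p q r + tsum m G' p q r.
Proof.
elim: m p q r => [|m IHm] p q r //=; rewrite !IHm.
by rewrite (AC (2*2*2*2) ((1*3*5*7)*(2*4*6*8))).
Qed.

End Sums.

Lemma tsum_morph (W W' : zmodType) (f : W -> W') m G p q r :
  {morph f : x y / x + y} ->
  tsum m (fun a b c => f (G a b c)) p q r = f (tsum m G p q r).
Proof.
by move=> fD; elim: m p q r => [|m IHm] p q r //=; rewrite !IHm !fD.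
Qed.

Lemma tsum_sum (W : zmodType) (I : Type) (s : seq I) m
    (G : I -> plane R -> plane R -> plane R -> W) p q r :
  tsum m (fun a b c => \sum_(i <- s) G i a b c) p q r =
  \sum_(i <- s) tsum m (G i) p q r.
Proof.
elim: m p q r => [|m IHm] p q r //=; rewrite !IHm -!big_split /=.
by [].
Qed.

End GridSums.

(** * Alternating forms on triangles *)

Section Alternating.
Variables (R : realType) (W : zmodType).
Implicit Types (b : plane R -> plane R -> W) (p q r u v w : plane R).

Definition alternating b := [/\ forall w, {morph b ^~ w : u v / u + v},
  forall u, {morph b u : v w / v + w} & forall u, b u u = 0].

(** For an alternating [b] this equals [b (q - p) (r - q)] ([tri_form_sides]); for [cross] it is
    twice the signed area. Written as a sum over edges, it can cancel along glued sides. *)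
Definition tri_form b p q r := b p q + b q r + b r p.

Variable b : plane R -> plane R -> W.
Hypothesis altb : alternating b.

Lemma altDl u v w : b (u + v) w = b u w + b v w.
Proof. by have [bD _ _] := altb; exact: bD. Qed.

Lemma altDr u v w : b u (v + w) = b u v + b u w.
Proof. by have [_ bD _] := altb; exact: bD. Qed.

Lemma altC u v : b v u = - b u v.
Proof.
case: altb => _ _ bvv; have := bvv (u + v).
rewrite altDl !altDr !bvv add0r addr0 => /eqP.
by rewrite addr_eq0 => /eqP ->; rewrite opprK.
Qed.

Lemma alt0 u : b 0 u = 0.
Proof. by apply: (addIr (b 0 u)); rewrite -altDl !add0r. Qed.

Lemma altNl u v : b (- u) v = - b u v.
Proof. by apply/eqP; rewrite -addr_eq0 -altDl addNr alt0. Qed.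

Lemma altNr u v : b u (- v) = - b u v.
Proof. by rewrite altC altNl opprK altC. Qed.

Lemma tri_formD p q r c : tri_form b (p + c) (q + c) (r + c) = tri_form b p q r.
Proof.
rewrite /tri_form !altDl !altDr; case: altb => _ _ ->; rewrite !addr0.
rewrite (altC q c) (altC r c) (altC p c).
rewrite (AC (3*3*3) ((1*4*7)*((2*9)*(5*3)*(8*6)))) /=.
by rewrite !subrr !addr0.
Qed.

Lemma tri_form_refl p q r c : tri_form b (c - p) (c - q) (c - r) = tri_form b p q r.
Proof.
rewrite -[RHS](tri_formD _ _ _ (- c)) /tri_form.
have opp2 u v : b (c - u) (c - v) = b (u - c) (v - c).
  by rewrite -(opprB u) -(opprB v) altNl altNr opprK.
by rewrite !opp2.
Qed.

Lemma tri_form_rot p q r : tri_form b p q r = tri_form b q r p.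
Proof. by rewrite /tri_form -addrA addrC. Qed.

Lemma tri_form_deg p q : [/\ tri_form b p p q = 0, tri_form b p q p = 0 &
  tri_form b q p p = 0].
Proof.
have [_ _ bvv] := altb.
have D1 u v : tri_form b u u v = 0 by rewrite /tri_form bvv add0r (altC u v) subrr.
by split; [|rewrite tri_form_rot tri_form_rot|rewrite tri_form_rot].
Qed.

(** In terms of the halved vertices, the outer triangles are translates of [p' q' r'] and the middle
    one is a point reflection of it, while doubling the vertices multiplies the form by 4. Halving
    is done in the plane, as [W] need not be divisible. *)
Lemma tri_form_subdivide p q r :
  tri_form b p (mid p q) (mid p r) + tri_form b (mid p q) q (mid q r)
  + tri_form b (mid p r) (mid q r) r + tri_form b (mid q r) (mid p r) (mid p q)
  = tri_form b p q r.
Proof.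
pose h u : plane R := 2%:R^-1 *: u.
have hh u : u = h u + h u.
  by rewrite /h; apply: plane_eqP; rewrite !mxE; field.
have midh u v : mid u v = h u + h v by rewrite /mid scalerDr.
rewrite !midh; set p' := h p; set q' := h q; set r' := h r.
rewrite (hh p) (hh q) (hh r) -/p' -/q' -/r'.
have -> : tri_form b (p' + p') (p' + q') (p' + r') = tri_form b p' q' r'.
  by rewrite -(tri_formD p' q' r' p') (addrC q') (addrC r').
have -> : tri_form b (p' + q') (q' + q') (q' + r') = tri_form b p' q' r'.
  by rewrite -(tri_formD p' q' r' q') (addrC r').
have -> : tri_form b (p' + r') (q' + r') (r' + r') = tri_form b p' q' r'.
  by rewrite -(tri_formD p' q' r' r').
have -> : tri_form b (q' + r') (p' + r') (p' + q') = tri_form b p' q' r'.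
  rewrite -[RHS](tri_form_refl _ _ _ (p' + q' + r')); congr tri_form;
    by apply: plane_eqP; rewrite !mxE; ring.
have b4 u v : b (u + u) (v + v) = b u v *+ 4.
  by rewrite altDl !altDr -!mulr2n -mulrnA.
have X4 (x : W) : x + x + x + x = x *+ 4 by rewrite -mulr2n -!mulrSr.
by rewrite X4 /tri_form !b4 -!mulrnDl.
Qed.

Lemma tsum_tri_form m p q r : tsum m (tri_form b) p q r = tri_form b p q r.
Proof.
by elim: m p q r => [|m IHm] p q r //=; rewrite !IHm tri_form_subdivide.
Qed.

(* Displacing the vertices by [d] changes [tri_form] by a sum over the edges. *)
Definition displacement_edge (d : plane R -> plane R) p q : W :=
  b (d p + d q) (q - p) + b (d p) (d q).

Lemma displacement_edge_anti d p q :
  displacement_edge d q p = - displacement_edge d p q.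
Proof.
rewrite /displacement_edge (altC (d p)) opprD.
by rewrite -(altNr _ (q - p)) opprB (addrC (d q)).
Qed.

Lemma tri_form_displace d p q r :
  tri_form b (p + d p) (q + d q) (r + d r) = tri_form b p q r +
  (displacement_edge d p q + displacement_edge d q r + displacement_edge d r p).
Proof.
(* The difference in the last brackets telescopes around the triangle. *)
have E u v : b (u + d u) (v + d v) =
    b u v + displacement_edge d u v + (b (d u) u - b (d v) v).
  rewrite /displacement_edge !altDl !altDr !altNr (altC u (d v)) opprK.
  rewrite [RHS](AC (1*((2*2)*1)*2) ((1*5)*(2*6)*((7*3)*(4*8)))) /=.
  by rewrite !subrr !addr0.
rewrite /tri_form !E.
rewrite [LHS](AC (3*3*3) ((1*4*7)*(2*5*8)*(3*6*9))) /=.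
rewrite [X in _ + X](AC (2*2*2) ((1*6)*(3*2)*(5*4))) /=.
by rewrite !subrr !addr0.
Qed.

End Alternating.

(** * Cancellation over glued edges *)

Section ClosedSums.
Variables (R : realType) (n : nat) (T : 'I_n -> triangle R).
Variable g : gluing (@triangle_figure R \o T).
Variables (S : topologicalType) (phi : 'I_n -> plane R -> S).
Hypothesis asm : assembled g phi.
Variable W : zmodType.
Hypothesis W2 : forall w : W, w *+ 2 = 0 -> w = 0.
Implicit Types (a b c : plane R).

(* The contributions of an edge and of its mate cancel. *)
Lemma tsum_closed m (E : 'I_n -> plane R -> plane R -> W) :
  (forall i a b, E i b a = - E i a b) ->
  (forall i j a b c (p q : S), chart_rep T phi p i a -> chart_rep T phi q i b ->
     chart_rep T phi p j (a + c) -> chart_rep T phi q j (b + c) ->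
     E j (a + c) (b + c) = E i a b) ->
  \sum_i tsum m (fun a b c => E i a b + E i b c + E i c a)
    (apex (T i) 0) (apex (T i) 1) (apex (T i) 2%:R) = 0.
Proof.
move=> EN Eglue; under eq_bigr => i _ do rewrite tsum_boundary //.
pose F (e : side_index (@triangle_figure R \o T)) : W :=
  esum m (E (hs_tri e)) (apex (T (hs_tri e)) (hs_idx e))
    (apex (T (hs_tri e)) (hs_idx e + 1)).
pose sides := {i : 'I_n & 'I_3}.
have F_mate e : F (mate g e) = - F e.
  rewrite /F -esum_anti // -apex_shift -apexS_shift.
  pose D x := region (triangle_figure (T (hs_tri e))) x /\
    wt (T (hs_tri e)) (hs_idx e + 2%:R) x = 0.
  have [n1 n2 n3] := ord3_neq (hs_idx e).
  apply: (@esum_translate _ _ D); last 2 first.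
  - by split; [exact: apex_region | rewrite wt_apex (negPf n3)].
  - by split; [exact: apex_region | rewrite wt_apex (negPf n2)].
  - move=> a b [aT a0] [bT b0]; split.
      rewrite midE; apply: region_convex => //.
      by rewrite invr_ge0 ler0n invf_le1 // ler1n.
    rewrite midE wtD dwtZ a0 add0r.
    have := wtD (T (hs_tri e)) (hs_idx e + 2%:R) a (b - a).
    by rewrite (addrC a) subrK b0 a0 add0r => <-; rewrite mulr0.
  - move=> a b [aT a0] [bT b0].
    apply: (Eglue _ _ _ _ _ (phi (hs_tri e) a) (phi (hs_tri e) b)) => //.
      exact: (mate_rep asm).
    exact: (mate_rep asm).
pose h : sides -> sides := mate g.
have h_inj : injective h by apply: inv_inj; exact: (mateK g).
(* Reindexing by the involution [mate] gives [X = - X], and [W] has no 2-torsion. *)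
pose X : W := \sum_(e : sides) F e.
have XN : X = - X.
  rewrite {1}/X (reindex_inj h_inj) /= -sumrN; apply: eq_bigr => e _.
  exact: F_mate.
have -> : \sum_(i < n) (esum m (E i) (apex (T i) 0) (apex (T i) 1)
    + esum m (E i) (apex (T i) 1) (apex (T i) 2%:R)
    + esum m (E i) (apex (T i) 2%:R) (apex (T i) 0)) = X.
  transitivity (\sum_(i < n) \sum_(k < 3) F (hside T i k)).
    apply: eq_bigr => i _; rewrite sum_ord3 /F /=.
    rewrite add0r (_ : 2%:R + 1 = 0 :> 'I_3) //; exact: val_inj.
  rewrite (sig_big_dep _ _ (fun i k => F (hside T i k))) /X.
  by apply: eq_bigr => -[].
by apply: W2; rewrite mulr2n {1}XN addNr.
Qed.

(** Subdivision changes nothing, and as [delta] is a function on the surface, the edge terms caused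
    by the displacement agree on glued sides and cancel. *)
Lemma tri_form_displaced_sum m (b : plane R -> plane R -> W) (delta : S -> plane R) :
  alternating b ->
  \sum_i tri_form b (apex (T i) 0) (apex (T i) 1) (apex (T i) 2%:R) =
  \sum_i tsum m (fun x y z =>
      tri_form b (x + delta (phi i x)) (y + delta (phi i y))
        (z + delta (phi i z)))
    (apex (T i) 0) (apex (T i) 1) (apex (T i) 2%:R).
Proof.
move=> altb; pose E i := displacement_edge b (fun x => delta (phi i x)).
have -> : \sum_i tri_form b (apex (T i) 0) (apex (T i) 1) (apex (T i) 2%:R) =
  \sum_i tsum m (tri_form b) (apex (T i) 0) (apex (T i) 1) (apex (T i) 2%:R)
  + \sum_i tsum m (fun a b c => E i a b + E i b c + E i c a)
    (apex (T i) 0) (apex (T i) 1) (apex (T i) 2%:R).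
  rewrite tsum_closed ?addr0.
  - by apply: eq_bigr => i _; rewrite tsum_tri_form.
  - by move=> i x y; apply: displacement_edge_anti.
  - move=> i j x y c p q [_ xp] [_ yq] [_ xp'] [_ yq'].
    rewrite /E /displacement_edge xp yq xp' yq'.
    by rewrite opprD addrACA subrr addr0.
rewrite -big_split /=; apply: eq_bigr => i _; rewrite -tsumD.
by congr tsum; apply/funext => x; apply/funext => y; apply/funext => z;
  rewrite -tri_form_displace.
Qed.

End ClosedSums.

(** * Simplicial approximation *)

(** The sign of the permutation that sends 0, 1, 2 to [k], [l], [m], and 0 when two of these
    coincide. *)
Definition sg3 (k l m : 'I_3) : int :=
  if (l == k + 1) && (m == k + 2%:R) then 1
  else if (l == k + 2%:R) && (m == k + 1) then -1 else 0.

Lemma sg3_eq0 k l m : [|| k == l, l == m | k == m] -> sg3 k l m = 0.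
Proof.
by case: (ord3P k) => ->; case: (ord3P l) => ->; case: (ord3P m) => ->.
Qed.

(** The signed passage along the side from [k0] to [k0 + 1]. *)
Definition step3 (k0 k l : 'I_3) : int :=
  ((k == k0) && (l == k0 + 1))%:R - ((l == k0) && (k == k0 + 1))%:R.

(** The closed path through three distinct corners uses every side once, forwards exactly when the
    permutation is even. *)
Lemma sg3_steps k0 k l m : k != l -> l != m -> k != m ->
  step3 k0 k l + step3 k0 l m + step3 k0 m k = sg3 k l m.
Proof.
by case: (ord3P k) => ->; case: (ord3P l) => ->; case: (ord3P m) => ->;
  case: (ord3P k0) => ->.
Qed.

Lemma tri_form_sg3 (R : realType) (W : zmodType) (b : plane R -> plane R -> W)
    (u : 'I_3 -> plane R) k l m : alternating b ->
  tri_form b (u k) (u l) (u m) = tri_form b (u 0) (u 1) (u 2%:R) *~ sg3 k l m.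
Proof.
move=> altb; have swap p q r : tri_form b p r q = - tri_form b p q r.
  rewrite /tri_form !opprD -!(altC altb).
  by rewrite (AC 3 (3*2*1)).
have deg p q := tri_form_deg altb p q.
case: (ord3P k) => ->; case: (ord3P l) => ->; case: (ord3P m) => ->;
  rewrite /sg3 /= ?mulr0z ?mulr1z ?mulrN1z -?swap //;
  first [ by case: (deg (u 0) (u 1)) | by case: (deg (u 0) (u 2%:R))
        | by case: (deg (u 1) (u 0)) | by case: (deg (u 1) (u 2%:R))
        | by case: (deg (u 2%:R) (u 0)) | by case: (deg (u 2%:R) (u 1))
        | by case: (deg (u 0) (u 0)) | by case: (deg (u 1) (u 1))
        | by case: (deg (u 2%:R) (u 2%:R))
        | by rewrite [LHS]tri_form_rot
        | by rewrite [LHS]tri_form_rot [LHS]tri_form_rot].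
Qed.

Lemma apex_inj (R : realType) (T : triangle R) : injective (apex T).
Proof.
move=> k l kl; have := wt_apex T k l; rewrite -kl wt_apex eqxx.
by case: (k =P l) => // _ /eqP; rewrite oner_eq0.
Qed.

Section Labelling.
Variables (R : realType) (S : translation_surface R).
Variables (n : nat) (T : 'I_n -> triangle R).
Variables (g : gluing (@triangle_figure R \o T)) (phi : 'I_n -> plane R -> S).
Hypothesis asm : assembled g phi.
Variables (lj : S -> 'I_n) (lk : S -> 'I_3) (ly : S -> plane R).
Implicit Types (p q : S) (x y z u v : plane R).
Implicit Types (e : side_index (@triangle_figure R \o T)).

(** The vector that pushes [p] to its label, the corner [lk p] of the triangle [lj p]. It depends on
    the point of the surface alone, as [tri_form_displaced_sum] requires. *)
Definition label_disp p : plane R := apex (T (lj p)) (lk p) - ly p.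

(* [z] is the coordinate of [p] in some chart in which [q] has coordinate [x];
   the label of [p] comes from a corner of a triangle containing [q]. *)
Definition corner_at q x p z := exists v,
  [/\ chart_rep T phi q (lj p) v, 0 < wt (T (lj p)) (lk p) v &
      z + label_disp p = x + (apex (T (lj p)) (lk p) - v)].

(** A side and its mate are one edge with opposite directions, whence the two alternatives. *)
Definition start_of e p := ((lj p == hs_tri e) && (lk p == hs_idx e)) ||
  ((lj p == hs_tri (mate g e)) && (lk p == hs_idx (mate g e) + 1)).

Definition end_of e p := ((lj p == hs_tri e) && (lk p == hs_idx e + 1)) ||
  ((lj p == hs_tri (mate g e)) && (lk p == hs_idx (mate g e))).

(* The displacement of the pushed edge is compared with the side [e] because the
   corners alone do not identify an edge: all corners may be the same point of
   the surface. *)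
Definition crosses e p y q z := [&& start_of e p, end_of e q &
  (z + label_disp q) - (y + label_disp p) ==
  apex (T (hs_tri e)) (hs_idx e + 1) - apex (T (hs_tri e)) (hs_idx e)].

Definition wall e p y q z : int := (crosses e p y q z)%:R - (crosses e q z p y)%:R.

(** Labels in the same triangle may come from different representatives of a nearby point; the two
    equations ensure that the pushed triangle is a translate of one spanned by corners of [T j]. *)
Definition cell_sign j p1 z1 p2 z2 p3 z3 : int :=
  if [&& lj p1 == j, lj p2 == j, lj p3 == j,
     (z2 + label_disp p2) - (z1 + label_disp p1) ==
       apex (T j) (lk p2) - apex (T j) (lk p1) &
     (z3 + label_disp p3) - (z1 + label_disp p1) ==
       apex (T j) (lk p3) - apex (T j) (lk p1)]
  then sg3 (lk p1) (lk p2) (lk p3) else 0.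

Lemma start_mate e p : start_of (mate g e) p = end_of e p.
Proof. by rewrite /start_of /end_of mateK orbC. Qed.

Lemma end_mate e p : end_of (mate g e) p = start_of e p.
Proof. by rewrite /start_of /end_of mateK orbC. Qed.

(** With positive weights at both ends of [e], the point [q] is inside the triangle or inside the
    side. It has at most two representatives, and the corners can be read off in each. *)
Lemma rep_corner_of_side q e u j v k : chart_rep T phi q (hs_tri e) u ->
  0 < wt (T (hs_tri e)) (hs_idx e) u -> 0 < wt (T (hs_tri e)) (hs_idx e + 1) u ->
  chart_rep T phi q j v ->
  (apex (T j) k - v = apex (T (hs_tri e)) (hs_idx e) - u ->
   ((j == hs_tri e) && (k == hs_idx e)) ||
   ((j == hs_tri (mate g e)) && (k == hs_idx (mate g e) + 1))) /\
  (apex (T j) k - v = apex (T (hs_tri e)) (hs_idx e + 1) - u ->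
   ((j == hs_tri e) && (k == hs_idx e + 1)) ||
   ((j == hs_tri (mate g e)) && (k == hs_idx (mate g e)))).
Proof.
move=> uq u0 u1 vq.
have [[-> ->]|[-> ->]] : (j, v) = (hs_tri e, u) \/
    (j, v) = (hs_tri (mate g e), u + shift g e).
  have [u2|u2] := eqVneq (wt (T (hs_tri e)) (hs_idx e + 2%:R) u) 0.
    exact: (edge_rep asm u2 u0 u1 uq vq).
  left; apply: (interior_rep_uniq asm _ uq vq) => l.
  case: (ord3_cases (hs_idx e) l) => -> //.
  by case: uq => /regionP u_ge0 _; rewrite lt_def u2 u_ge0.
- by rewrite !eqxx; split=> /addIr/apex_inj ->; rewrite eqxx.
- rewrite !eqxx; split=> /(canRL (subrK _)); rewrite addrA subrK.
    by rewrite (apex_shift g e) => /apex_inj ->; rewrite eqxx orbT.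
  by rewrite (apexS_shift g e) => /apex_inj ->; rewrite eqxx orbT.
Qed.

Let germ_diff (V : zmodType) (s1 s2 x g1 g2 d : V) :
  s1 = x + g1 -> s2 = x + g2 -> s2 - s1 = d -> g2 = g1 + d.
Proof. by move=> -> -> <-; rewrite opprD addrACA subrr add0r (addrC g1) subrK. Qed.

(** A crossing forces [q] to have positive weights at both ends of [e], in the triangle of [e] or of
    its mate. Then [rep_corner_of_side] recovers labels from pushed positions. *)
Lemma crosses_side q x e p1 z1 p2 z2 :
  corner_at q x p1 z1 -> corner_at q x p2 z2 -> crosses e p1 z1 p2 z2 ->
  forall p z, corner_at q x p z ->
  (z + label_disp p = z1 + label_disp p1 -> start_of e p) /\
  (z + label_disp p = z2 + label_disp p2 -> end_of e p).
Proof.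
move=> [v1 [v1q v1_gt0 E1]] [v2 [v2q v2_gt0 E2]] /and3P[st _ /eqP E12] p z.
move=> [v [vq v_gt0 E]].
have germ2 := germ_diff E1 E2 E12.
have germ1 : z + label_disp p = z1 + label_disp p1 ->
    apex (T (lj p)) (lk p) - v = apex (T (lj p1)) (lk p1) - v1.
  by rewrite E E1 => /addrI.
have germ1' : z + label_disp p = z2 + label_disp p2 ->
    apex (T (lj p)) (lk p) - v = apex (T (lj p2)) (lk p2) - v2.
  by rewrite E E2 => /addrI.
case/orP: st => /andP[/eqP lj1 /eqP lk1].
- rewrite lj1 in v1q v1_gt0 germ2 germ1; rewrite lk1 in v1_gt0 germ2 germ1.
  have germ2' : apex (T (lj p2)) (lk p2) - v2 = apex (T (hs_tri e)) (hs_idx e + 1) - v1.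
    by rewrite germ2 addrC addrA subrK.
  have [l [lE wl _]] := corner_transfer asm v2q v1q v2_gt0.
  have w1 : 0 < wt (T (hs_tri e)) (hs_idx e + 1) v1.
    by rewrite -wl in v2_gt0; move: lE v2_gt0; rewrite germ2' => /addIr/apex_inj ->.
  have [H1 H2] := rep_corner_of_side (lk p) v1q v1_gt0 w1 vq.
  by split=> [/germ1/H1|/germ1']; last by rewrite germ2' => /H2.
- rewrite lj1 in v1q v1_gt0 germ2 germ1; rewrite lk1 in v1_gt0 germ2 germ1.
  have germ2' : apex (T (lj p2)) (lk p2) - v2 =
      apex (T (hs_tri (mate g e))) (hs_idx (mate g e)) - v1.
    rewrite germ2 -(opprB (apex _ (hs_idx e))) -(mate_sideE g e).
    by rewrite opprB addrC addrA subrK.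
  have [l [lE wl _]] := corner_transfer asm v2q v1q v2_gt0.
  have w1 : 0 < wt (T (hs_tri (mate g e))) (hs_idx (mate g e)) v1.
    by rewrite -wl in v2_gt0; move: lE v2_gt0; rewrite germ2' => /addIr/apex_inj ->.
  have [H1 H2] := rep_corner_of_side (lk p) v1q w1 v1_gt0 vq.
  rewrite -start_mate -(end_mate e); split=> [/germ1/H2|/germ1']; first by [].
  by rewrite germ2' => /H1.
Qed.

(** The pushed triangle collapses to an edge that is traversed once in each direction; by
    [crosses_side], coinciding pushed vertices are interchangeable in a crossing. *)
Lemma wall_coincident q x e p1 z1 p2 z2 p3 z3 :
  corner_at q x p1 z1 -> corner_at q x p2 z2 -> corner_at q x p3 z3 ->
  z1 + label_disp p1 = z2 + label_disp p2 ->
  wall e p1 z1 p2 z2 + wall e p2 z2 p3 z3 + wall e p3 z3 p1 z1 = 0.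
Proof.
move=> c1 c2 c3 z12.
have no_self (p p' : S) (z z' : plane R) :
    z + label_disp p = z' + label_disp p' -> crosses e p z p' z' = false.
  move=> zz; apply/negP => /and3P[_ _]; rewrite zz subrr eq_sym -sideE.
  by rewrite (negPf (side_neq0 _ _)).
have move_end p z p' z' p'' z'' : corner_at q x p z -> corner_at q x p' z' ->
    corner_at q x p'' z'' -> z' + label_disp p' = z'' + label_disp p'' ->
    crosses e p z p' z' -> crosses e p z p'' z''.
  move=> c c' c'' zz cr; have [st _ E] := and3P cr.
  have [_ en] := crosses_side c c' cr c''.
  by apply/and3P; split=> //; [exact: en | rewrite -zz].
have move_start p z p' z' p'' z'' : corner_at q x p z -> corner_at q x p' z' ->
    corner_at q x p'' z'' -> z + label_disp p = z'' + label_disp p'' ->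
    crosses e p z p' z' -> crosses e p'' z'' p' z'.
  move=> c c' c'' zz cr; have [_ en E] := and3P cr.
  have [st _] := crosses_side c c' cr c''.
  by apply/and3P; split=> //; [exact: st | rewrite -zz].
have z21 := esym z12.
rewrite /wall (no_self _ _ _ _ z12) (no_self _ _ _ _ z21).
have -> : crosses e p2 z2 p3 z3 = crosses e p1 z1 p3 z3 :> bool.
  by apply/idP/idP; apply: move_start.
have -> : crosses e p3 z3 p2 z2 = crosses e p3 z3 p1 z1 :> bool.
  by apply/idP/idP; apply: move_end.
by rewrite subr0 add0r addrC subrKA subrr.
Qed.

Definition central (p1 p2 p3 : S) (z1 z2 z3 : plane R) := exists q x,
  [/\ corner_at q x p1 z1, corner_at q x p2 z2 & corner_at q x p3 z3].

(** All labels are transferred to the triangle of the first one. If the three corners are distinct,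
    [q] has positive weights at all of them, so it is interior and has a single representative. *)
Lemma central_cases p1 p2 p3 z1 z2 z3 : central p1 p2 p3 z1 z2 z3 ->
  [\/ z1 + label_disp p1 = z2 + label_disp p2,
      z2 + label_disp p2 = z3 + label_disp p3 |
      z3 + label_disp p3 = z1 + label_disp p1] \/
  exists j c, [/\ lj p1 = j, lj p2 = j & lj p3 = j] /\
    [/\ z1 + label_disp p1 = c + apex (T j) (lk p1),
        z2 + label_disp p2 = c + apex (T j) (lk p2) &
        z3 + label_disp p3 = c + apex (T j) (lk p3)] /\
    [/\ lk p1 != lk p2, lk p2 != lk p3 & lk p1 != lk p3].
Proof.
move=> [q [x [[v1 [q1 w1 E1]] [v2 [q2 w2 E2]] [v3 [q3 w3 E3]]]]].
have [->|n12] := eqVneq (z1 + label_disp p1) (z2 + label_disp p2);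
  first by left; apply: Or31.
have [->|n23] := eqVneq (z2 + label_disp p2) (z3 + label_disp p3);
  first by left; apply: Or32.
have [->|n31] := eqVneq (z3 + label_disp p3) (z1 + label_disp p1);
  first by left; apply: Or33.
right; have [l2 [g2 wl2 _]] := corner_transfer asm q2 q1 w2.
have [l3 [g3 wl3 _]] := corner_transfer asm q3 q1 w3.
rewrite E1 E2 E3 -g2 -g3 in n12 n23 n31.
rewrite !(inj_eq (addrI x)) !(inj_eq (addIr _)) !(inj_eq (@apex_inj _ _)) in n12 n23 n31.
have v1_gt0 l : 0 < wt (T (lj p1)) l v1.
  have : l \in [:: lk p1; l2; l3].
    case: (ord3P l) n12 n23 n31 => ->; case: (ord3P (lk p1)) => ->;
      by case: (ord3P l2) => ->; case: (ord3P l3) => ->.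
  by rewrite !inE => /or3P[] /eqP -> //; rewrite ?wl2 ?wl3.
have [j2 v2E] : lj p2 = lj p1 /\ v2 = v1.
  by have [-> ->] := interior_rep_uniq asm v1_gt0 q1 q2.
have [j3 v3E] : lj p3 = lj p1 /\ v3 = v1.
  by have [-> ->] := interior_rep_uniq asm v1_gt0 q1 q3.
rewrite j2 v2E in E2 g2; rewrite j3 v3E in E3 g3.
have l2E : l2 = lk p2 by apply: (@apex_inj _ (T (lj p1))); move/addIr: g2.
have l3E : l3 = lk p3 by apply: (@apex_inj _ (T (lj p1))); move/addIr: g3.
exists (lj p1), (x - v1); split=> //; split.
  by split; rewrite ?E1 ?E2 ?E3 addrCA addrC.
by rewrite -l2E -l3E; split=> //; rewrite eq_sym.
Qed.

Lemma cell_sign_coincident j p1 p2 p3 z1 z2 z3 :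
  [\/ z1 + label_disp p1 = z2 + label_disp p2,
      z2 + label_disp p2 = z3 + label_disp p3 |
      z3 + label_disp p3 = z1 + label_disp p1] ->
  cell_sign j p1 z1 p2 z2 p3 z3 = 0.
Proof.
rewrite /cell_sign => E; case: ifP => // /and5P[_ _ _ /eqP E2 /eqP E3].
apply: sg3_eq0; case: E => E; rewrite E ?subrr in E2 E3.
- move/esym/eqP: E2; rewrite subr_eq0 => /eqP/apex_inj ->.
  by rewrite eqxx.
- by move: E2; rewrite E3 => /addIr/apex_inj ->; rewrite eqxx orbT.
- move/esym/eqP: E3; rewrite subr_eq0 => /eqP/apex_inj ->.
  by rewrite eqxx !orbT.
Qed.

Lemma cell_sign_interior j j0 c p1 p2 p3 z1 z2 z3 :
  lj p1 = j0 -> lj p2 = j0 -> lj p3 = j0 ->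
  z1 + label_disp p1 = c + apex (T j0) (lk p1) ->
  z2 + label_disp p2 = c + apex (T j0) (lk p2) ->
  z3 + label_disp p3 = c + apex (T j0) (lk p3) ->
  cell_sign j p1 z1 p2 z2 p3 z3 =
  if j0 == j then sg3 (lk p1) (lk p2) (lk p3) else 0.
Proof.
move=> j1 j2 j3 E1 E2 E3; rewrite /cell_sign j1 j2 j3 E1 E2 E3.
have [<-|//] := eqVneq j0 j.
have cB u v : (c + u) - (c + v) = u - v :> plane R.
  by rewrite opprD addrACA subrr add0r.
by rewrite !cB !eqxx.
Qed.

Lemma crosses_interior e j c p1 p2 z1 z2 : lj p1 = j -> lj p2 = j ->
  z1 + label_disp p1 = c + apex (T j) (lk p1) ->
  z2 + label_disp p2 = c + apex (T j) (lk p2) ->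
  crosses e p1 z1 p2 z2 =
  [&& j == hs_tri e, lk p1 == hs_idx e & lk p2 == hs_idx e + 1] ||
  [&& j == hs_tri (mate g e), lk p1 == hs_idx (mate g e) + 1 &
      lk p2 == hs_idx (mate g e)].
Proof.
move=> j1 j2 E1 E2; rewrite /crosses /start_of /end_of j1 j2 E1 E2.
have cB u v : (c + u) - (c + v) = u - v :> plane R.
  by rewrite opprD addrACA subrr add0r.
rewrite cB; have /eqP/negPf tri_neq := @mate_tri_neq R n T g e.
have [je|je] := eqVneq j (hs_tri e).
  rewrite je ?eqxx (eq_sym (hs_tri e)) tri_neq /= !orbF.
  case: (lk p1 =P _) => //= ->; case: (lk p2 =P _) => //= ->.
  by rewrite eqxx.
have [je'|//] := eqVneq j (hs_tri (mate g e)).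
rewrite je' /=; case: (lk p1 =P _) => //= ->; case: (lk p2 =P _) => //= ->.
by rewrite -opprB mate_sideE opprB eqxx.
Qed.

(** Both sides vanish if two pushed vertices coincide. Otherwise the pushed triangle is a copy, up
    to orientation, of one triangle of [T], and its boundary runs along [e] only if [e] or its mate
    is a side of that triangle, with opposite signs in the two cases. *)
Lemma wall_cell_sign e p1 p2 p3 z1 z2 z3 : central p1 p2 p3 z1 z2 z3 ->
  wall e p1 z1 p2 z2 + wall e p2 z2 p3 z3 + wall e p3 z3 p1 z1 =
  cell_sign (hs_tri e) p1 z1 p2 z2 p3 z3 -
  cell_sign (hs_tri (mate g e)) p1 z1 p2 z2 p3 z3.
Proof.
move=> cen; have [q [x [c1 c2 c3]]] := cen.
have [E|[j [c [[j1 j2 j3] [[E1 E2 E3] [n12 n23 n13]]]]]] := central_cases cen.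
  rewrite !cell_sign_coincident // subrr; case: E => E.
  - exact: (wall_coincident e c1 c2 c3 E).
  - by rewrite -[RHS](wall_coincident e c2 c3 c1 E) -addrA addrC.
  - by rewrite -[RHS](wall_coincident e c3 c1 c2 E) addrC addrA.
rewrite !(cell_sign_interior _ j1 j2 j3 E1 E2 E3).
have wallE k0 l0 p p' z z' : lj p = j -> lj p' = j ->
    z + label_disp p = c + apex (T j) (lk p) ->
    z' + label_disp p' = c + apex (T j) (lk p') ->
    hs_idx e = k0 -> hs_idx (mate g e) = l0 ->
    wall e p z p' z' =
    (if j == hs_tri e then step3 k0 (lk p) (lk p') else 0) -
    (if j == hs_tri (mate g e) then step3 l0 (lk p) (lk p') else 0).
  move=> pj p'j Ep Ep' <- <-; rewrite /wall.
  rewrite (crosses_interior e pj p'j Ep Ep') (crosses_interior e p'j pj Ep' Ep).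
  have /eqP/negPf tri_neq := @mate_tri_neq R n T g e.
  rewrite /step3; have [->|je] := eqVneq j (hs_tri e).
    by rewrite ?eqxx (eq_sym (hs_tri e)) tri_neq /= !orbF subr0.
  have [_|_] /= := eqVneq j (hs_tri (mate g e)); last by rewrite !subrr.
  by rewrite sub0r opprB; congr (_%:R - _%:R); rewrite andbC.
rewrite !(wallE _ _ _ _ _ _ _ _ _ _ erefl erefl) //.
have [je|je] := eqVneq j (hs_tri e); have [je'|je'] := eqVneq j (hs_tri (mate g e)).
- by case: (@mate_tri_neq R n T g e); rewrite -je -je'.
- by rewrite !subr0 sg3_steps.
- by rewrite !sub0r -!opprD sg3_steps.
- by rewrite !subr0.
Qed.

Lemma tri_form_cell_sign (W : zmodType) (b : plane R -> plane R -> W)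
    p1 p2 p3 z1 z2 z3 : alternating b -> central p1 p2 p3 z1 z2 z3 ->
  tri_form b (z1 + label_disp p1) (z2 + label_disp p2) (z3 + label_disp p3) =
  \sum_j tri_form b (apex (T j) 0) (apex (T j) 1) (apex (T j) 2%:R)
     *~ cell_sign j p1 z1 p2 z2 p3 z3.
Proof.
move=> altb cen.
have [E|[j [c [[j1 j2 j3] [[E1 E2 E3] _]]]]] := central_cases cen.
  rewrite big1 => [|j _]; last by rewrite cell_sign_coincident // mulr0z.
  case: E => ->.
  - by have [] := tri_form_deg altb (z2 + label_disp p2) (z3 + label_disp p3).
  - by have [] := tri_form_deg altb (z3 + label_disp p3) (z1 + label_disp p1).
  - by have [] := tri_form_deg altb (z1 + label_disp p1) (z2 + label_disp p2).
rewrite (bigD1 j) //= big1 ?addr0 => [|j' j'j]; last first.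
  by rewrite (cell_sign_interior _ j1 j2 j3 E1 E2 E3) eq_sym (negPf j'j) mulr0z.
rewrite (cell_sign_interior _ j1 j2 j3 E1 E2 E3) eqxx E1 E2 E3 -tri_form_sg3 //.
by rewrite ![c + _]addrC tri_formD.
Qed.

End Labelling.

(** * The degree *)

(** The triangles with the value [f i] cover a set that is open and closed in the connected
    space. *)
Lemma mate_invariant_const (R : realType) (n : nat) (T : 'I_n -> triangle R)
    (g : gluing (@triangle_figure R \o T)) (S : topologicalType)
    (phi : 'I_n -> plane R -> S) (X : Type) (f : 'I_n -> X) :
  assembled g phi -> connected [set: S] ->
  (forall e, f (hs_tri (mate g e)) = f (hs_tri e)) -> forall i j, f i = f j.
Proof.
move=> asm connS f_mate i j.
pose A := [set p : S | exists l x, chart_rep T phi p l x /\ f l = f i].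
(* Gluing steps preserve [f], so membership in [A] can be tested on any representative. *)
have A_rep p l x : chart_rep T phi p l x -> A p <-> f l = f i.
  move=> xp; split=> [[l' [x' [xp' <-]]]|]; last by exists l, x.
  apply: (@glue_ind R n T g (fun a => f a.1 = f l') (l', x') (l, x) _
    (rep_glued asm xp' xp)) => // a b /glue_stepP[e [ae _ _ ->]] /=.
  by rewrite f_mate -ae.
(* The preimage of [B] in each triangle is everything or empty, hence closed. *)
have clA (Q : 'I_n -> Prop) (B : set S) :
    (forall l x, region (triangle_figure (T l)) x -> B (phi l x) <-> Q l) -> closed B.
  move=> BQ; case: asm => _ _ closedE; apply/closedE => l.
  have [Ql|Ql] := pselect (Q l).
    rewrite (_ : _ `&` _ = region (triangle_figure (T l))); first exact: region_closed.
    by apply/seteqP; split=> [x []|x xT] //; split=> //; apply/BQ.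
  rewrite (_ : _ `&` _ = set0); first exact: closed0.
  by apply/seteqP; split=> [x [xT /BQ]|x] //; move/(_ xT).
have AT : A = setT.
  apply: connS.
  - by exists (phi i (apex (T i) 0)), i, (apex (T i) 0); do !split; apply: apex_region.
  - exists A; last by rewrite setTI.
    rewrite -[A]setCK; apply: closed_openC.
    apply: (clA (fun l => f l <> f i)) => l x xT /=.
    by split=> nA fl; apply: nA; apply/(A_rep _ l x).
  - exists A; last by rewrite setTI.
    by apply: (clA (fun l => f l = f i)) => l x xT; apply: (A_rep _ l x).
apply/esym/(A_rep (phi j (apex (T j) 0)) j (apex (T j) 0)).
  by split=> //; apply: apex_region.
by rewrite AT.
Qed.

Section Degree.
Variables (R : realType) (S : translation_surface R).
Variables (n n' : nat) (T : 'I_n -> triangle R) (T' : 'I_n' -> triangle R).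
Variables (g : gluing (@triangle_figure R \o T)).
Variables (g' : gluing (@triangle_figure R \o T')).
Variables (phi : 'I_n -> plane R -> S) (phi' : 'I_n' -> plane R -> S).
Hypotheses (triT : flat_triangulation g phi) (triT' : flat_triangulation g' phi').

Let asm : assembled g phi. Proof. by case: triT. Qed.
Let asm' : assembled g' phi'. Proof. by case: triT'. Qed.

Lemma label_exists : exists (lj : S -> 'I_n') (lk : S -> 'I_3) (ly : S -> plane R),
  forall p, chart_rep T' phi' p (lj p) (ly p) /\
            1 / 3%:R <= wt (T' (lj p)) (lk p) (ly p).
Proof.
have : forall p : S, exists l : 'I_n' * 'I_3 * plane R,
    chart_rep T' phi' p l.1.1 l.2 /\ 1 / 3%:R <= wt (T' l.1.1) l.1.2 l.2.
  move=> p; have [j [y yp]] := rep_exists asm' p.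
  have [k yk] : exists k, 1 / 3%:R <= wt (T' j) k y.
    have := wt_sum (T' j) y; rewrite sum_ord3 => y1.
    have [y0|y0] := lerP (1 / 3%:R) (wt (T' j) 0 y); first by exists 0.
    have [y2|y2] := lerP (1 / 3%:R) (wt (T' j) 1 y); first by exists 1.
    by exists 2%:R; lra.
  by exists (j, k, y).
move=> /choice[l lP].
by exists (fun p => (l p).1.1), (fun p => (l p).1.2), (fun p => (l p).2).
Qed.

Variables (lj : S -> 'I_n') (lk : S -> 'I_3) (ly : S -> plane R).
Hypothesis labelP : forall p, chart_rep T' phi' p (lj p) (ly p) /\
            1 / 3%:R <= wt (T' (lj p)) (lk p) (ly p).

(** Near a point [x], [local_translation] carries all labels to representatives of [phi i x];
    compactness of the triangles makes the radius uniform. *)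
Lemma small_central : exists2 e, 0 < e & forall i a b c,
  region (triangle_figure (T i)) a -> region (triangle_figure (T i)) b ->
  region (triangle_figure (T i)) c -> `|a - b| < e -> `|b - c| < e -> `|a - c| < e ->
  central T' phi' lj lk ly (phi i a) (phi i b) (phi i c) a b c.
Proof.
have [r0 r00 r0P] : exists2 r, 0 < r & forall j k h, `|h| < r ->
    `|dwt (T' j) k h| < 1 / 3%:R.
  apply: common_radius => [j r s _ sr rP k h hs|j]; last exact: dwt_small.
  by apply: rP; apply: lt_le_trans sr.
apply: common_radius => [i r s _ sr rP a b c aT bT cT ab bc ac|i].
  by apply: rP => //; apply: lt_le_trans sr.
pose near_central x e := forall a b c,
  region (triangle_figure (T i)) a -> region (triangle_figure (T i)) b ->
  region (triangle_figure (T i)) c -> `|a - x| < e -> `|b - x| < e -> `|c - x| < e ->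
  central T' phi' lj lk ly (phi i a) (phi i b) (phi i c) a b c.
have loc x : region (triangle_figure (T i)) x -> exists2 r, 0 < r & near_central x r.
  move=> xT; have [r r_gt0 rP] := local_translation triT triT' xT.
  exists (Num.min r r0) => [|a b c aT bT cT ax bx cx]; first by rewrite lt_min r_gt0.
  suff cor z : region (triangle_figure (T i)) z -> `|z - x| < Num.min r r0 ->
      corner_at T' phi' lj lk ly (phi i x) x (phi i z) z.
    by exists (phi i x), x; split; apply: cor.
  move=> zT; rewrite lt_min => /andP[zxr zx0].
  have [lz lz3] := labelP (phi i z).
  (* The label coordinate is translated back from [z] to [x]; its weight drops by less than
     [1 / 3%:R] and stays positive. *)
  exists (ly (phi i z) - (z - x)); split; first exact: rP.
    rewrite wtD dwtN subr_gt0; apply: lt_le_trans lz3.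
    by apply: le_lt_trans (r0P _ _ _ zx0); apply: ler_norm.
  rewrite /label_disp; apply: plane_eqP; rewrite !mxE; ring.
have [e [e_gt0 eP]] : exists e, 0 < e /\
    region (triangle_figure (T i)) `<=` near_central ^~ e.
  have near_cov := (compact_near_coveringP _).1 (@region_compact R (T i)).
  have /(_ _) covered := near_cov R (0^'+) (fun e x => near_central x e) _.
  have [|e [eP e0]] := @filter_ex _ (0 : R)^'+ _ _
      (filterI (covered _) (nbhs_right_gt (0 : R))); last by exists e.
  move=> x /loc[r r0' rP].
  (* Half of the radius is kept for moving the centre from [x] to [x']. *)
  exists (ball x (r / 2%:R), [set e | e < r / 2%:R]) => /=.
    split; first by apply: nbhsx_ballx; rewrite divr_gt0.
    by apply: nbhs_right_lt; rewrite divr_gt0.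
  move=> [x' e] /= []; rewrite -ball_normE /= => xx' e2 a b c aT bT cT ax bx cx.
  have tri z : `|z - x'| < e -> `|z - x| < r.
    move=> zx; rewrite -(subrKA x'); apply: le_lt_trans (ler_normD _ _) _.
    by rewrite [ltRHS](splitr r) ltrD ?(lt_trans zx) // distrC.
  by apply: rP => //; apply: tri.
exists e => // a b c aT bT cT ab bc ac; apply: (eP a aT) => //.
- by rewrite subrr normr0.
- by rewrite distrC.
- by rewrite distrC.
Qed.

(* [d j] is the signed number of small triangles pushed onto the [j]-th triangle
   of [T']. *)
Lemma degree_sum : exists d : 'I_n' -> int,
  (forall e, d (hs_tri (mate g' e)) = d (hs_tri e)) /\
  forall (W : zmodType) (b : plane R -> plane R -> W),
  (forall w : W, w *+ 2 = 0 -> w = 0) -> alternating b ->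
  \sum_i tri_form b (apex (T i) 0) (apex (T i) 1) (apex (T i) 2%:R) =
  \sum_j tri_form b (apex (T' j) 0) (apex (T' j) 1) (apex (T' j) 2%:R) *~ d j.
Proof.
have [e e_gt0 eP] := small_central.
(* Enough subdivisions to make all small triangles smaller than [e]. *)
have [m mP] : exists m, forall i k l, `|apex (T i) k - apex (T i) l| < 2%:R ^+ m * e.
  pose B := \sum_i \sum_k \sum_l `|apex (T i) k - apex (T i) l|.
  exists (Num.Def.archi_bound (B / e)) => i k l.
  rewrite -ltr_pdivrMr //; apply: le_lt_trans (upper_nthrootP (leqnn _)).
  rewrite ler_pM2r ?invr_gt0 // /B (bigD1 i) //= (bigD1 k) //= (bigD1 l) //=.
  by rewrite -!addrA lerDl !addr_ge0 ?sumr_ge0 // => ? _; rewrite ?sumr_ge0 // => ? _;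
    rewrite sumr_ge0.
have grid_eq (W : zmodType) (G G' : 'I_n -> plane R -> plane R -> plane R -> W) :
    (forall i a b c,
      central T' phi' lj lk ly (phi i a) (phi i b) (phi i c) a b c ->
      G i a b c = G' i a b c) ->
    \sum_i tsum m (G i) (apex (T i) 0) (apex (T i) 1) (apex (T i) 2%:R) =
    \sum_i tsum m (G' i) (apex (T i) 0) (apex (T i) 1) (apex (T i) 2%:R).
  move=> GG'; apply: eq_bigr => i _.
  apply: (@eq_tsum_small _ _ (region (triangle_figure (T i))) e) => //;
    try exact: apex_region.
    move=> a b aT bT; rewrite midE; apply: region_convex => //.
    by rewrite invr_ge0 ler0n invf_le1 // ler1n.
  by move=> a b c aT bT cT ab bc ac; apply: GG'; apply: eP.
pose sign j i a b c := cell_sign T' lj lk ly j (phi i a) a (phi i b) b (phi i c) c.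
exists (fun j => \sum_i tsum m (sign j i)
  (apex (T i) 0) (apex (T i) 1) (apex (T i) 2%:R)).
split=> [s|W b W2 altb].
  apply/esym/eqP; rewrite -subr_eq0 -sumrB; apply/eqP.
  (* The difference of the degrees on the two sides of [s] is a sum of signed crossings, an
     antisymmetric edge function that cancels over glued sides. *)
  pose E i a b := wall g' lj lk ly s (phi i a) a (phi i b) b.
  transitivity (\sum_i tsum m (fun a b c => E i a b + E i b c + E i c a)
      (apex (T i) 0) (apex (T i) 1) (apex (T i) 2%:R)); last first.
    apply: (tsum_closed asm).
    - by move=> w /eqP; rewrite mulrn_eq0 => /eqP.
    - by move=> i x y; rewrite /E /wall opprB.
    - move=> i j x y c p q [_ xp] [_ yq] [_ xp'] [_ yq'].
      rewrite /E /wall xp yq xp' yq' /crosses.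
      have cB (u v : plane R) : (y + c + u) - (x + c + v) = (y + u) - (x + v).
        by apply: plane_eqP; rewrite !mxE; ring.
      have cB' (u v : plane R) : (x + c + v) - (y + c + u) = (x + v) - (y + u).
        by apply: plane_eqP; rewrite !mxE; ring.
      by rewrite cB cB'.
  transitivity (\sum_i tsum m (fun a b c =>
      sign (hs_tri s) i a b c + - sign (hs_tri (mate g' s)) i a b c)
      (apex (T i) 0) (apex (T i) 1) (apex (T i) 2%:R)).
    apply: eq_bigr => i _; rewrite tsumD; congr (_ + _).
    by rewrite (tsum_morph (f := -%R)) // => x y; rewrite opprD.
  apply: grid_eq => i x y z cen; rewrite /E.
  by rewrite (wall_cell_sign asm' s cen).
rewrite (tri_form_displaced_sum asm W2 m (label_disp T' lj lk ly) altb).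
pose t j := tri_form b (apex (T' j) 0) (apex (T' j) 1) (apex (T' j) 2%:R).
transitivity (\sum_i tsum m (fun a b c => \sum_j t j *~ sign j i a b c)
    (apex (T i) 0) (apex (T i) 1) (apex (T i) 2%:R)).
  by apply: grid_eq => i x y z cen; rewrite (tri_form_cell_sign asm' altb cen).
under eq_bigr => i _ do rewrite tsum_sum.
rewrite exchange_big; apply: eq_bigr => j _ /=.
rewrite mulrz_sumr; apply: eq_bigr => i _.
by rewrite (tsum_morph (f := intmul (t j))) // => x y; rewrite mulrzDr.
Qed.

End Degree.

(** The degrees agree across every edge, hence everywhere by connectedness. As [d] is chosen before
    [W] and [b], it can be computed with one form and used with another. *)
Lemma degree_exists (R : realType) (S : translation_surface R) (n n' : nat)
    (T : 'I_n -> triangle R) (T' : 'I_n' -> triangle R) :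
  triangulates S T -> triangulates S T' -> exists d : int,
  forall (W : zmodType) (b : plane R -> plane R -> W),
  (forall w : W, w *+ 2 = 0 -> w = 0) -> alternating b ->
  \sum_i tri_form b (apex (T i) 0) (apex (T i) 1) (apex (T i) 2%:R) =
  (\sum_j tri_form b (apex (T' j) 0) (apex (T' j) 1) (apex (T' j) 2%:R)) *~ d.
Proof.
move=> [g [phi triT]] [g' [phi' triT']]; have [asm' _ _] := triT'.
have [lj [lk [ly labelP]]] := label_exists triT'.
have [d [d_mate dP]] := degree_sum triT triT' labelP.
have [p _] := ts_nonempty S; have [j0 _] := rep_exists asm' p.
exists (d j0) => W b W2 altb; rewrite (dP W b W2 altb).
rewrite mulrz_suml; apply: eq_bigr => j _; congr (_ *~ _).
exact: (mate_invariant_const asm' (@ts_connected _ S) d_mate).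
Qed.

(** * Independence of the triangulation *)

Lemma cross_alternating (R : realType) : alternating (@cross R).
Proof.
by split=> [w u v|u v w|u]; rewrite /cross ?mxE /=; ring.
Qed.

Lemma wedge_alternating (R : realType) :
  alternating (fun u v : plane R =>
    wedge (u : rat_space (plane R)) (v : rat_space (plane R))).
Proof.
by split=> [w u v|u v w|u]; [exact: wedgeDl | exact: wedgeDr | exact: wedgevv].
Qed.

Lemma tri_form_sides (R : realType) (W : zmodType) (b : plane R -> plane R -> W) p q r :
  alternating b -> tri_form b p q r = b (q - p) (r - q).
Proof.
move=> altb; rewrite /tri_form !(altDl altb) !(altDr altb) !(altNl altb) !(altNr altb).
case: (altb) => _ _ ->; rewrite subr0 opprK (altC altb r p) opprK.
by rewrite [LHS](AC 3 (2*(3*1))).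
Qed.

(** The degree is found from [cross], that is from areas, and then used with [wedge]. *)
Lemma J_sum_unique (R : realType) (S : translation_surface R) (n n' : nat)
    (T : 'I_n -> triangle R) (T' : 'I_n' -> triangle R) :
  triangulates S T -> triangulates S T' -> J_sum T = J_sum T'.
Proof.
move=> ST ST'; have [d dP] := degree_exists ST ST'.
have [d' d'P] := degree_exists ST' ST.
have R2 (x : R) : x *+ 2 = 0 -> x = 0 by move=> /eqP; rewrite mulrn_eq0 => /eqP.
pose area m (U : 'I_m -> triangle R) := \sum_i tri_area (U i).
have areaE m (U : 'I_m -> triangle R) : area m U =
    \sum_i tri_form (@cross R) (apex (U i) 0) (apex (U i) 1) (apex (U i) 2%:R).
  by apply: eq_bigr => i _; rewrite tri_form_sides //; apply: cross_alternating.
have := dP _ _ R2 (@cross_alternating R).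
have := d'P _ _ R2 (@cross_alternating R).
rewrite -!areaE => A' A.
have area_gt0 m (U : 'I_m -> triangle R) : triangulates S U -> 0 < area m U.
  move=> [g [phi [asm _ _]]]; have [p _] := ts_nonempty S.
  have [j _] := rep_exists asm p; rewrite /area (bigD1 j) //=.
  by rewrite ltr_pwDl ?sumr_ge0 ?apex_ccw // => i _; rewrite ltW ?apex_ccw.
have A_gt0 := area_gt0 _ _ ST; have A'_gt0 := area_gt0 _ _ ST'.
have d1 : d = 1.
  (* Each total area is an integral multiple of the other, and neither is zero. *)
  have dd' : d * d' = 1.
    have : area _ T *~ (d' * d) = area _ T *~ 1 by rewrite mulrzA -A' -A mulr1z.
    rewrite -!(mulrzr (area _ T)) => /(mulfI (lt0r_neq0 A_gt0)) /intr_inj <-.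
    exact: mulrC.
  have d_gt0 : 0 < d by rewrite -(pmulrz_rgt0 _ A'_gt0) -A.
  have d'_gt0 : 0 < d' by rewrite -(pmulrz_rgt0 _ A_gt0) -A'.
  case: d d' dd' d_gt0 d'_gt0 {dP d'P A A'} => [d|//] [d'|//] /eqP.
  by rewrite eqz_nat muln_eq1 => /andP[/eqP -> _].
(* A rational vector space has no 2-torsion. *)
have W2 (w : wedge2 (rat_space (plane R))) : w *+ 2 = 0 -> w = 0.
  by move=> /eqP; rewrite -scaler_nat scaler_eq0 pnatr_eq0 /= => /eqP.
have := dP _ _ W2 (@wedge_alternating R); rewrite d1 mulr1z.
under eq_bigr do rewrite (tri_form_sides _ _ _ (@wedge_alternating R)).
by under [in RHS]eq_bigr do rewrite (tri_form_sides _ _ _ (@wedge_alternating R)).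
Qed.

(** Both surfaces are triangulated by the same triangles, so they have the same [J_invariant],
    through which alone the periodic directions depend on the surface. *)
Theorem theorem1p11 (R : realType) (S S' : translation_surface R) (K : set R) :
  scissors_congruent S S' ->
  algebraically_periodic S /\ periodic_direction_field S K ->
  algebraically_periodic S' /\ periodic_direction_field S' K.
Proof.
move=> [n [T [ST S'T]]].
(* The default case of [xgetP] is excluded because [T] itself triangulates [U]. *)
have JE (U : translation_surface R) : triangulates U T -> J_invariant U = J_sum T.
  move=> UT; rewrite /J_invariant; case: xgetP => [j _ [m [V [UV ->]]]|/(_ (J_sum T))].
    exact: (J_sum_unique UV UT).
  by case; exists n, T.
have dirE v : algebraically_periodic_direction S v =
    algebraically_periodic_direction S' v.
  by rewrite /algebraically_periodic_direction /SAF !JE.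
have dirE' : algebraically_periodic_direction S =
    algebraically_periodic_direction S'.
  exact/funext.
rewrite /algebraically_periodic /periodic_direction_field /normalizing_basis.
by rewrite /periodic_slope dirE'.
Qed.
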